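(* Let $p>0$ and let $(\psi_j)_{j\in\mathbb{Z}}$ be the Cauchy wavelets of order $p$ with dilation factor $a=2$. There exist a constant $A$ depending only on $p$ and, for every $\lambda\in\,]0;1[$, functions $M\mapsto\alpha_M$ and $M\mapsto\alpha'_M$ of $M>0$ (depending only on $\lambda$ and $M$) which tend to $0$ exponentially as $M\to+\infty$, such that the following holds. Let $\epsilon,c,\lambda\in\,]0;1[$ and $M>0$ with $c\geq\epsilon$, let $j\in\mathbb{Z}$, and let $f^{(1)},f^{(2)}\in L^2(\mathbb{R})$ be non-zero functions with $\hat f^{(1)}(\omega)=\hat f^{(2)}(\omega)=0$ for a.e. $\omega<0$. Assume that, for all $x\in[-M2^j;M2^j]$, $$\left||f^{(1)}\star\psi_j(x)|^2-|f^{(2)}\star\psi_j(x)|^2\right|\leq\epsilon N_j^2,$$ $$\left||f^{(1)}\star\psi_{j+1}(x)|^2-|f^{(2)}\star\psi_{j+1}(x)|^2\right|\leq\epsilon N_{j+1}^2,$$ and $$|f^{(1)}\star\psi_j(x)|^2,\ |f^{(2)}\star\psi_j(x)|^2\geq cN_j^2,$$ $$|f^{(1)}\star\psi_{j+1}(x)|^2,\ |f^{(2)}\star\psi_{j+1}(x)|^2\geq cN_{j+1}^2 .$$ If $1/3-\alpha_M>0$ and $4/5-\alpha'_M>0$, then for all $x\in[-\lambda^2M2^j;\lambda^2M2^j]$, $$\left|\frac{f^{(1)}\star\psi_{j+2}}{f^{(1)}\star\psi_{j+1}}(x)-\frac{f^{(2)}\star\psi_{j+2}}{f^{(2)}\star\psi_{j+1}}(x)\right|\leq\frac{A}{c}\left(\frac{N_{j-1}}{N_{j+1}}\right)^{4/3}\epsilon^{(1/3-\alpha_M)(4/5-\alpha'_M)}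 .$$
   Context: Fourier transform: $\hat f(\omega)=\int_{\mathbb{R}}f(x)e^{-i\omega x}dx$, extended to $L^2$. The Cauchy wavelets of order $p$ with dilation factor $2$ are given by $\hat\psi_j(\omega)=\hat\psi(2^j\omega)$ with $\hat\psi(\omega)=\omega^pe^{-\omega}1_{\omega>0}$. The function $f\star\psi_j$ (continuous and bounded) has Fourier transform $\hat f\hat\psi_j$. For each $j$, $N_j=\sup_{x\in\mathbb{R},\,s=1,2}|f^{(s)}\star\psi_j(x)|$. ''Tends to $0$ exponentially'' means bounded in absolute value by $Ce^{-\gamma M}$ for all large $M$, for some constants $C,\gamma>0$ (which may depend on $\lambda$). *)

(* Defs.v *)
From HB Require Import structures.
From mathcomp Require Import all_boot all_order all_algebra.
From mathcomp Require Import all_classical all_reals all_analysis.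
From mathcomp Require Export complex.
Set Implicit Arguments.
Unset Strict Implicit.
Unset Printing Implicit Defensive.
Import Order.TTheory GRing.Theory Num.Theory.
Import numFieldNormedType.Exports.
Local Open Scope classical_set_scope.
Local Open Scope ring_scope.
Local Open Scope complex_scope.


Notation normc := Normc.normc.

Section CauchyWavelets.
Context {R : realType}.
Local Notation mu := (@lebesgue_measure R).
Implicit Types (f g : R -> R[i]) (p x w : R) (j : int).

Definition cmeasurable f : Prop :=
  measurable_fun setT (fun x => complex.Re (f x)) /\
  measurable_fun setT (fun x => complex.Im (f x)).

Definition cintegral f : R[i] :=
  Rintegral mu setT (fun x => complex.Re (f x)) +i*
  Rintegral mu setT (fun x => complex.Im (f x)).

Definition cLnorm (q : \bar R) f : \bar R :=
  Lnorm mu q (fun x => (normc (f x))%:E).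

Definition inL (q : \bar R) f : Prop :=
  cmeasurable f /\ (cLnorm q f < +oo)%E.

Definition expi (t : R) : R[i] := cos t +i* sin t.

(* On L^1, with the convention \int f(x) exp(-iwx) dx. *)
Definition fourier1 f w : R[i] :=
  cintegral (fun x => f x * expi (- (w * x))).

(* [g] is the Fourier transform of [f] in the L^2 sense: the pair (f, g)
   belongs to the closure in L^2 x L^2 of the graph of [fourier1] restricted to
   L^1 \cap L^2, i.e. g is the value at f of the continuous extension of the
   integral transform.  By Plancherel, every f in L^2 has such a g, unique up to
   a.e. equality. *)
Definition is_fourier2 f g : Prop :=
  [/\ inL 2%:E f, inL 2%:E g &
   exists u : nat -> R -> R[i],
    [/\ forall n, inL 1%:E (u n) /\ inL 2%:E (u n),
        cLnorm 2%:E (fun x => u n x - f x) @[n --> \oo] --> 0%E &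
        cLnorm 2%:E (fun w => fourier1 (u n) w - g w) @[n --> \oo] --> 0%E]].

Definition cauchy_hat p w : R :=
  if 0 < w then w `^ p * expR (- w) else 0.

(* The wavelet psi_j whose Fourier transform is w |-> cauchy_hat p (2^j w): as
   the latter is integrable, psi_j is given by the inversion formula. *)
Definition cauchy_wavelet p j x : R[i] :=
  ((2 * pi)^-1)%:C *
  cintegral (fun w => (cauchy_hat p (2 ^ j * w))%:C * expi (w * x)).

Definition convolution f g x : R[i] :=
  cintegral (fun t => f t * g (x - t)).

Definition wavelet_transform p j f : R -> R[i] :=
  convolution f (cauchy_wavelet p j).

(* The set is bounded for f1, f2 in L^2, so that [sup] is the actual supremum. *)
Definition wavelet_sup p (f1 f2 : R -> R[i]) j : R :=
  sup [set r | exists x, r = normc (wavelet_transform p j f1 x) \/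
                         r = normc (wavelet_transform p j f2 x)].

Definition tends_to0_exponentially (a : R -> R) : Prop :=
  exists C gamma : R, [/\ 0 < C, 0 < gamma &
    \forall M \near +oo, `|a M| <= C * expR (- (gamma * M))].

End CauchyWavelets.

(* Main.v *)
Require Import Defs.
From mathcomp Require Import all_boot all_order all_algebra.
From mathcomp Require Import all_classical all_reals all_analysis.
From mathcomp Require Import measurable_realfun.
From mathcomp Require Import ring lra.
Import Order.TTheory GRing.Theory Num.Theory.
Import numFieldNormedType.Exports.
Local Open Scope classical_set_scope.
Local Open Scope ring_scope.
Local Open Scope complex_scope.

Set Implicit Arguments.
Unset Strict Implicit.
Unset Printing Implicit Defensive.

(** For Im z > 0 put Psi_q(z) = \int_0^oo w^q exp(i w z) dw
    ([power_laplace]).  Up to a positive constant the Cauchy wavelet at scale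
    2^k is x |-> Psi_p(x + i 2^k), so all the transforms of one function f are,
    up to constants, the restrictions to the lines Im z = 2^k of a single
    holomorphic function F(z) = \int f(t) Psi_p(z - t) dt ([extension],
    [wavelet_transformE]).  The theorem is thus a statement about two
    holomorphic functions F1, F2 on the upper half plane ([ratio_stability]).
    Let h = 2^j and let B(y) be the supremum of |F1| and |F2| on Im z = y, which
    also bounds them above that line ([half_plane_bound]).

    - The function H(z) = F1(z) F1(z^* + 4ih)^* - F2(z) F2(z^* + 4ih)^* is
      holomorphic, equals |F1|^2 - |F2|^2 on Im z = 2h and is at most
      2 B(h/2) B(2h) where h/2 <= Im z <= 2h.  It is smaller by a factor eps on
      a segment of the top line, so a two-constants theorem makes it smaller by
      a factor eps^(3/10) on a shorter segment of Im z = h, which lies one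
      third of the way up.
    - On Im z = h the moduli of F1 and F2 are close as well; with the bound on H
      this shows that K(z) = F1(z + 2ih) F2(z) - F2(z + 2ih) F1(z) is at most
      3 B(h/2) B(2h) eps^(3/10) there ([cross_product_bound_max], the only place
      where eps <= c matters).
    - K is holomorphic and bounded above Im z = h.  The two-constants theorem on
      h <= Im z <= 21h bounds it at height 2h with the exponent 19/21, and
      dividing by F1 F2, whose modulus is at least c B(2h)^2, gives the claim.

    The exponent obtained is 3/10 * 19/21 = 19/70 > 4/15 = 1/3 * 4/5.  On the
    infinite strip h/2 <= Im z <= 2h the first factor would be 1/3; a rectangle
    of bounded aspect ratio only loses a little of it, and the second rectangle
    is taken tall enough to win more than that loss back over 4/5.  Hence
    the corrections alpha and alpha' may be taken equal to 0 as soon as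
    M >= 106 / (1 - lambda^2), which leaves room for both rectangles around
    every point considered; for smaller M they are set to 1, which makes the
    positivity assumptions fail.

    The maximum principle rests on second-order expansions ([jet2]): averaging
    over four points z + r, z - r, z + ir, z - ir kills both the linear and the
    quadratic term, so that no interior point is a strict maximum.  The two-constants
    theorem follows by applying it to g exp(L phi) with phi a polynomial of
    degree 2.  The analytic input is the decay of Psi_q along horizontal lines,
    which makes it square integrable: integration by parts shows that
    |Psi_q(z)| |z|^(q + 1) is constant ([normc_power_laplace_cst]). *)

(** * Complex modulus *)

Section ComplexModulus.
Context {R : realType}.
Implicit Types (z w : R[i]) (x y : R).

Lemma normcE2 x y : normc (x +i* y) ^+ 2 = x ^+ 2 + y ^+ 2.
Proof. by rewrite sqr_sqrtr// addr_ge0// sqr_ge0. Qed.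

Lemma normc_ge0 z : 0 <= normc z.
Proof. by case: z => x y; exact: sqrtr_ge0. Qed.

Lemma normc_eq0 z : (normc z == 0) = (z == 0).
Proof.
by apply/eqP/eqP => [/Normc.eq0_normc//|->]; exact: Normc.normc0.
Qed.

Lemma normc_real x : normc x%:C = `|x|.
Proof. by rewrite /= expr0n addr0 sqrtr_sqr. Qed.

Lemma normc_conj z : normc (conjc z) = normc z.
Proof. by case: z => x y /=; rewrite sqrrN. Qed.

Lemma normcX z n : normc (z ^+ n) = normc z ^+ n.
Proof.
elim: n => [|n IH]; first by rewrite !expr0 Normc.normc1.
by rewrite !exprS Normc.normcM IH.
Qed.

Lemma normcB z w : normc (z - w) <= normc z + normc w.
Proof. by rewrite -(normcN w); exact: le_normcD. Qed.

Lemma normc_distC z w : normc (z - w) = normc (w - z).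
Proof. by rewrite -normcN opprB. Qed.

Lemma Re_normc z : `|complex.Re z| <= normc z.
Proof.
case: z => x y /=; rewrite -sqrtr_sqr ler_sqrt ?addr_ge0 ?sqr_ge0//.
by rewrite lerDl sqr_ge0.
Qed.

Lemma Im_normc z : `|complex.Im z| <= normc z.
Proof.
case: z => x y /=; rewrite -sqrtr_sqr ler_sqrt ?addr_ge0 ?sqr_ge0//.
by rewrite lerDr sqr_ge0.
Qed.

Lemma normc_le_ReIm z : normc z <= `|complex.Re z| + `|complex.Im z|.
Proof.
case: z => x y.
have -> : x +i* y = x%:C + 'i * y%:C.
  by simpc; rewrite ?addr0 ?add0r.
apply: (le_trans (le_normcD _ _)); rewrite Normc.normcM !normc_real.
by simpc => /=; rewrite expr0n expr1n add0r sqrtr1 mul1r lexx.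
Qed.

(** Modulus bounds reduce to bounds on real parts: rotate the number onto the
    positive axis.  This turns statements on complex-valued functions and
    integrals into statements on real ones. *)
Lemma normc_dual z : exists zeta : R[i],
  normc zeta <= 1 /\ complex.Re (zeta * z) = normc z.
Proof.
have [->|z0] := eqVneq z 0.
  by exists 0; rewrite mulr0 Normc.normc0; split.
exists (conjc z / (normc z)%:C); split.
  rewrite Normc.normcM normc_conj Normc.normcV normc_real.
  by rewrite (ger0_norm (normc_ge0 z)) mulfV// normc_eq0.
have n0 : normc z != 0 by rewrite normc_eq0.
rewrite mulrAC -(complexr0 (normc z)) /=.
suff -> : conjc z * z = ((normc z) ^+ 2)%:C.
  by simpc => /=; rewrite expr0n addr0; field.
by case: z {z0 n0} => x y; rewrite normcE2; simpc; congr (_ +i* _); ring.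
Qed.

Lemma normc_le_dual z C :
  (forall zeta, normc zeta <= 1 -> complex.Re (zeta * z) <= C) -> normc z <= C.
Proof. by move=> zC; have [u [u1 <-]] := normc_dual z; exact: zC. Qed.

Lemma Re_dual_le zeta z : normc zeta <= 1 -> complex.Re (zeta * z) <= normc z.
Proof.
move=> z1; apply: le_trans (ler_norm _) _; apply: le_trans (Re_normc _) _.
by rewrite Normc.normcM ler_piMl// normc_ge0.
Qed.

End ComplexModulus.

(** * Second-order expansions *)

Section PowerRemainders.
Context {R : realType}.
Implicit Types (g : R[i] -> R[i]) (z w : R[i]).

(** E(h) = O(h^n) as h tends to 0, with explicit constants. *)
Definition Oh (n : nat) (E : R[i] -> R[i]) := exists C r : R,
  [/\ 0 <= C, 0 < r & forall h, normc h <= r -> normc (E h) <= C * normc h ^+ n].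

Lemma Oh_ext n E1 E2 : E1 =1 E2 -> Oh n E1 -> Oh n E2.
Proof. by move=> e [C [r [C0 r0 H]]]; exists C, r; split => // h /H; rewrite e. Qed.

Lemma OhD n E1 E2 : Oh n E1 -> Oh n E2 -> Oh n (fun h => E1 h + E2 h).
Proof.
move=> [C [r [C0 r0 H]]] [D [s [D0 s0 K]]]; exists (C + D), (Num.min r s).
split; [exact: addr_ge0|by rewrite lt_min r0 s0|move=> h].
rewrite le_min => /andP[hr hs]; apply: le_trans (le_normcD _ _) _.
by rewrite mulrDl lerD ?H ?K.
Qed.

Lemma OhM n m E1 E2 : Oh n E1 -> Oh m E2 -> Oh (n + m) (fun h => E1 h * E2 h).
Proof.
move=> [C [r [C0 r0 H]]] [D [s [D0 s0 K]]]; exists (C * D), (Num.min r s).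
split; [exact: mulr_ge0|by rewrite lt_min r0 s0|move=> h].
rewrite le_min => /andP[hr hs]; rewrite Normc.normcM exprD mulrACA.
by rewrite ler_pM ?normc_ge0 ?H ?K.
Qed.

Lemma Oh_cst c : Oh 0 (fun=> c).
Proof.
by exists (normc c), 1; split; rewrite ?normc_ge0// => h _; rewrite expr0 mulr1.
Qed.

Lemma Oh_id : Oh 1 id.
Proof. by exists 1, 1; split => // h _; rewrite expr1 mul1r. Qed.

Lemma OhW n m E : (n <= m)%N -> Oh m E -> Oh n E.
Proof.
move=> nm [C [r [C0 r0 H]]]; exists C, (Num.min r 1).
split; [by []|by rewrite lt_min r0 ltr01|move=> h].
rewrite le_min => /andP[hr h1]; apply: le_trans (H _ hr) _.
by rewrite ler_wpM2l// ler_wiXn2l// normc_ge0.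
Qed.

Lemma OhN n E : Oh n E -> Oh n (fun h => - E h).
Proof.
by move=> [C [r [C0 r0 H]]]; exists C, r; split => // h hr; rewrite normcN H.
Qed.

Lemma OhZ n c E : Oh n E -> Oh n (fun h => c * E h).
Proof. by move=> H; exact: (OhM (Oh_cst c) H). Qed.

Lemma OhXn n : Oh n (fun h => h ^+ n).
Proof. by exists 1, 1; split => // h _; rewrite normcX mul1r. Qed.

(** Holomorphy at z to the order that the maximum principle needs; it passes to
    products and to [cexp] by pure algebra on remainders. *)
Definition jet2 g z := exists a b : R[i],
  Oh 3 (fun h => g (z + h) - g z - a * h - b * h ^+ 2).

Lemma jet2_Oh1 g z : jet2 g z -> Oh 1 (fun h => g (z + h) - g z).
Proof.
move=> [a [b H]].
apply: (@Oh_ext _ (fun h => (g (z + h) - g z - a * h - b * h ^+ 2)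
   + (a * h + b * h ^+ 2))); first by move=> h; ring.
apply: OhD; first exact: OhW H.
apply: OhD; apply: OhZ; first exact: Oh_id.
exact: OhW (OhXn 2).
Qed.

Lemma jet2D g1 g2 z : jet2 g1 z -> jet2 g2 z -> jet2 (fun z => g1 z + g2 z) z.
Proof.
move=> [a [b H]] [a' [b' H']]; exists (a + a'), (b + b').
by apply: Oh_ext (OhD H H') => h; ring.
Qed.

Lemma jet2N g z : jet2 g z -> jet2 (fun z => - g z) z.
Proof.
move=> [a [b H]]; exists (- a), (- b).
by apply: Oh_ext (OhN H) => h; ring.
Qed.

Lemma jet2_cst c z : jet2 (fun=> c) z.
Proof.
exists 0, 0; apply: (@Oh_ext _ (fun=> 0)); first by move=> h; ring.
by exists 0, 1; split => // h _; rewrite Normc.normc0 mul0r.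
Qed.

Lemma jet2_id z : jet2 id z.
Proof.
exists 1, 0; apply: (@Oh_ext _ (fun=> 0)); first by move=> h; ring.
by exists 0, 1; split => // h _; rewrite Normc.normc0 mul0r.
Qed.

Lemma jet2M g1 g2 z : jet2 g1 z -> jet2 g2 z -> jet2 (fun z => g1 z * g2 z) z.
Proof.
move=> J1 J2; have O1 := jet2_Oh1 J1; have O2 := jet2_Oh1 J2.
move: J1 J2 => [a [b H]] [a' [b' H']].
exists (a * g2 z + g1 z * a'), (b * g2 z + g1 z * b' + a * a').
pose r1 h := g1 (z + h) - g1 z - a * h - b * h ^+ 2.
pose r2 h := g2 (z + h) - g2 z - a' * h - b' * h ^+ 2.
(* With Di the increment of gi, D1 D2 - a a' h^2 = D1 (D2 - a' h) +
   (D1 - a h) a' h, and each product is O(h^3). *)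
have X : Oh 3 (fun h => (g1 (z + h) - g1 z) * (b' * h ^+ 2 + r2 h)
    + (b * h ^+ 2 + r1 h) * (a' * h)).
  apply: OhD; first (apply: (@OhM 1 2) => //).
    by apply: OhD; [exact: OhZ (OhXn 2)|exact: OhW H'].
  apply: (@OhM 2 1); last exact: OhZ Oh_id.
  by apply: OhD; [exact: OhZ (OhXn 2)|exact: OhW H].
have Y := OhD X (OhD (OhZ (g2 z) H) (OhZ (g1 z) H')).
by apply: Oh_ext Y => h; rewrite /r1 /r2; ring.
Qed.

(** Schwarz reflection: conjugating both the variable and the value keeps
    holomorphic functions holomorphic. *)
Lemma jet2_reflect g c z :
  jet2 g (conjc z + c) -> jet2 (fun z => conjc (g (conjc z + c))) z.
Proof.
move=> [a [b [C [r [C0 r0 H]]]]]; exists (conjc a), (conjc b), C, r; split=> // h hr.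
have := H (conjc h); rewrite normc_conj => /(_ hr); rewrite -normc_conj.
congr (normc _ <= _).
rewrite !expr2 !rmorphB !rmorphM /= !conjcK rmorphD /=.
by rewrite [_ + c + _]addrAC.
Qed.

Lemma jet2_shift g c z : jet2 g (z + c) -> jet2 (fun z => g (z + c)) z.
Proof.
move=> [a [b H]]; exists a, b; apply: Oh_ext H => h.
by rewrite (addrAC z h c).
Qed.

End PowerRemainders.

(** * Taylor bounds for the complex exponential *)

Section RealTaylor.
Context {R : realType}.
Implicit Types (f g : R -> R) (x df dg : R).

Lemma derD f g x df dg : is_derive x 1 f df -> is_derive x 1 g dg ->
  is_derive x 1 (fun t => f t + g t) (df + dg).
Proof. by move=> hf hg; exact: is_deriveD. Qed.

Lemma derB f g x df dg : is_derive x 1 f df -> is_derive x 1 g dg ->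
  is_derive x 1 (fun t => f t - g t) (df - dg).
Proof. by move=> hf hg; exact: is_deriveB. Qed.

Lemma derM f g x df dg : is_derive x 1 f df -> is_derive x 1 g dg ->
  is_derive x 1 (fun t => f t * g t) (df * g x + f x * dg).
Proof.
move=> hf hg; apply: is_derive_eq (is_deriveM hf hg) _.
by rewrite /GRing.scale /= addrC mulrC.
Qed.

Lemma der_cst c x : is_derive x 1 (fun=> c : R) 0.
Proof. exact: is_derive_cst. Qed.

Lemma der_id x : is_derive x 1 (fun t : R => t) 1.
Proof. exact: is_derive_id. Qed.

Lemma derMl c f x df : is_derive x 1 f df ->
  is_derive x 1 (fun t => c * f t) (c * df).
Proof.
move=> hf; apply: is_derive_eq (derM (der_cst c x) hf) _.
by rewrite mul0r add0r.
Qed.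

Lemma der_comp f g x df dg : is_derive (g x) 1 f df -> is_derive x 1 g dg ->
  is_derive x 1 (fun t => f (g t)) (df * dg).
Proof. by move=> hf hg; apply: is_derive1_comp. Qed.

Lemma der_continuous f x df : is_derive x 1 f df -> {for x, continuous f}.
Proof. by move=> [] /derivable1_diffP /differentiable_continuous. Qed.

Lemma der_within f (df : R -> R) (a b : R) :
  (forall t : R, a <= t <= b -> is_derive t 1 f (df t)) ->
  {within `[a, b], continuous f}.
Proof.
move=> H; apply: derivable_within_continuous => t; rewrite in_itv /= => /H.
by case.
Qed.

(** Starting from 0, one integration over [0, 1] does not worsen a bound; the
    Taylor estimates below iterate this. *)
Lemma der_bound f (df : R -> R) (C : R) :
  (forall t : R, 0 <= t <= 1 -> is_derive t 1 f (df t)) ->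
  (forall t : R, 0 <= t <= 1 -> `|df t| <= C) -> f 0 = 0 ->
  forall t : R, 0 <= t <= 1 -> `|f t| <= C.
Proof.
move=> D B f0 t /andP[t0 t1].
have D' s : 0 <= s <= t -> is_derive s 1 f (df s).
  by move=> /andP[s0 st]; apply: D; rewrite s0 (le_trans st).
have [|c + e] := @MVT_segment _ f df 0 t t0 _ (der_within D').
  by move=> x; rewrite in_itv /= => /andP[x0 xt]; apply: D'; rewrite !ltW.
rewrite in_itv /= => /andP[c0 ct]; move: e; rewrite f0 !subr0 => ->.
have cB : `|df c| <= C by apply: B; rewrite c0 (le_trans ct).
rewrite normrM (ger0_norm t0); apply: le_trans cB.
by rewrite ler_piMr.
Qed.

Lemma taylor1 (r0 r1 r2 : R -> R) (C : R) :
  (forall t : R, 0 <= t <= 1 -> is_derive t 1 r0 (r1 t)) ->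
  (forall t : R, 0 <= t <= 1 -> is_derive t 1 r1 (r2 t)) ->
  (forall t : R, 0 <= t <= 1 -> `|r2 t| <= C) ->
  `|r0 1 - r0 0 - r1 0| <= C.
Proof.
move=> D0 D1 B.
have H1 := @der_bound (fun t => r1 t - r1 0) r2 C.
have {}H1 : forall t : R, 0 <= t <= 1 -> `|r1 t - r1 0| <= C.
  apply: H1 => //; last by rewrite subrr.
  move=> t /D1 h; apply: is_derive_eq (derB h (der_cst _ _)) _.
  by rewrite subr0.
have H0 : forall t : R, 0 <= t <= 1 -> `|r0 t - r0 0 - r1 0 * t| <= C.
  apply: (@der_bound _ (fun t => r1 t - r1 0) C) => //; last first.
    by rewrite subrr mulr0 subr0.
  move=> t /D0 h.
  apply: is_derive_eq (derB (derB h (der_cst _ _)) (derMl _ (der_id _))) _.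
  by rewrite subr0 mulr1.
by have := H0 1; rewrite mulr1; apply; rewrite ler01 lexx.
Qed.

Lemma taylor2 (r0 r1 r2 r3 : R -> R) (C : R) :
  (forall t : R, 0 <= t <= 1 -> is_derive t 1 r0 (r1 t)) ->
  (forall t : R, 0 <= t <= 1 -> is_derive t 1 r1 (r2 t)) ->
  (forall t : R, 0 <= t <= 1 -> is_derive t 1 r2 (r3 t)) ->
  (forall t : R, 0 <= t <= 1 -> `|r3 t| <= C) ->
  `|r0 1 - r0 0 - r1 0 - r2 0 / 2| <= C.
Proof.
move=> D0 D1 D2 B.
have H2 : forall t : R, 0 <= t <= 1 -> `|r2 t - r2 0| <= C.
  apply: (@der_bound (fun t => r2 t - r2 0) r3 C) => //; last by rewrite subrr.
  move=> t /D2 h; apply: is_derive_eq (derB h (der_cst _ _)) _.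
  by rewrite subr0.
have H1 : forall t : R, 0 <= t <= 1 -> `|r1 t - r1 0 - r2 0 * t| <= C.
  apply: (@der_bound _ (fun t => r2 t - r2 0) C) => //; last first.
    by rewrite subrr mulr0 subr0.
  move=> t /D1 h.
  apply: is_derive_eq (derB (derB h (der_cst _ _)) (derMl _ (der_id _))) _.
  by rewrite subr0 mulr1.
have H0 : forall t : R, 0 <= t <= 1 ->
    `|r0 t - r0 0 - r1 0 * t - r2 0 / 2 * (t * t)| <= C.
  apply: (@der_bound _ (fun t => r1 t - r1 0 - r2 0 * t) C) => //; last first.
    by rewrite subrr !mulr0 !subr0.
  move=> t /D0 h.
  apply: is_derive_eq (derB (derB (derB h (der_cst _ _)) (derMl _ (der_id _)))
    (derMl _ (derM (der_id _) (der_id _)))) _.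
  by field.
by have := H0 1; rewrite !mulr1; apply; rewrite ler01 lexx.
Qed.

End RealTaylor.

Section ComplexExponential.
Context {R : realType}.
Implicit Types (z w : R[i]) (x y t : R).

Definition cexp z : R[i] := (expR (complex.Re z))%:C * expi (complex.Im z).

Lemma expiD x y : expi (x + y) = expi x * expi y :> R[i].
Proof. by rewrite /expi cosD sinD; simpc; congr (_ +i* _); ring. Qed.

Lemma normc_expi t : normc (expi t) = 1 :> R.
Proof. by rewrite /expi /= cos2Dsin2 sqrtr1. Qed.

Lemma cexpD z w : cexp (z + w) = cexp z * cexp w.
Proof.
by case: z => a b; case: w => c d; rewrite /cexp /= expRD expiD rmorphM; ring.
Qed.

Lemma normc_cexp z : normc (cexp z) = expR (complex.Re z).
Proof.
by rewrite /cexp Normc.normcM normc_expi mulr1 normc_real ger0_norm// expR_ge0.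
Qed.

(** Differentiating along a real line multiplies the dual vector zeta by w, so
    that one lemma provides the derivatives of every order. *)
Lemma der_Re_cexp (zeta w : R[i]) t :
  is_derive t 1 (fun t => complex.Re (zeta * cexp (t%:C * w)))
    (complex.Re (zeta * w * cexp (t%:C * w))).
Proof.
case: zeta => u v; case: w => a b.
have E s : complex.Re ((u +i* v) * cexp (s%:C * (a +i* b))) =
    expR (a * s) * (u * cos (b * s) - v * sin (b * s)).
  by rewrite /cexp /expi; simpc => /=; rewrite (mulrC s a) (mulrC s b); ring.
rewrite (funext E).
have Da := derMl a (der_id t); have Db := derMl b (der_id t).
apply: is_derive_eq (derM (der_comp (is_derive_expR _) Da)
  (derB (derMl u (der_comp (is_derive_cos _) Db))
        (derMl v (der_comp (is_derive_sin _) Db)))) _.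
by rewrite /cexp /expi; simpc => /=; rewrite (mulrC t a) (mulrC t b); ring.
Qed.

Let cexp_line_bound (zeta w : R[i]) t : 0 <= t <= 1 -> normc zeta <= 1 ->
  forall n, `|complex.Re (zeta * w ^+ n * cexp (t%:C * w))|
    <= normc w ^+ n * expR (normc w).
Proof.
move=> /andP[t0 t1] z1 n; apply: le_trans (Re_normc _) _.
rewrite (Normc.normcM (zeta * _)) (Normc.normcM zeta) normcX normc_cexp.
apply: ler_pM; rewrite ?mulr_ge0 ?exprn_ge0 ?normc_ge0 ?expR_ge0//.
  by rewrite ler_piMl ?exprn_ge0 ?normc_ge0.
rewrite ler_expR; apply: le_trans (ler_norm _) _; apply: le_trans (Re_normc _) _.
by rewrite Normc.normcM normc_real (ger0_norm t0) ler_piMl ?normc_ge0.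
Qed.

Lemma cexp0 : cexp 0 = 1 :> R[i].
Proof.
by rewrite /cexp /expi /= expR0 cos0 sin0; simpc.
Qed.

Lemma cexp_taylor1 w :
  normc (cexp w - 1 - w) <= normc w ^+ 2 * expR (normc w).
Proof.
apply: normc_le_dual => zeta z1.
have D n t : is_derive t 1 (fun t => complex.Re (zeta * w ^+ n * cexp (t%:C * w)))
    (complex.Re (zeta * w ^+ n.+1 * cexp (t%:C * w))).
  by rewrite exprSr (mulrA zeta (w ^+ n)); exact: der_Re_cexp.
have := taylor1 (fun t _ => D 0%N t) (fun t _ => D 1%N t)
  (fun t ht => cexp_line_bound w ht z1 2).
apply: le_trans; apply: le_trans (ler_norm _).
rewrite mul1r mul0r cexp0 expr0 expr1 !mulr1.
by rewrite !mulrBr mulr1 !raddfB.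
Qed.

Lemma cexp_taylor2 w :
  normc (cexp w - 1 - w - w ^+ 2 / 2) <= normc w ^+ 3 * expR (normc w).
Proof.
apply: normc_le_dual => zeta z1.
have D n t : is_derive t 1 (fun t => complex.Re (zeta * w ^+ n * cexp (t%:C * w)))
    (complex.Re (zeta * w ^+ n.+1 * cexp (t%:C * w))).
  by rewrite exprSr (mulrA zeta (w ^+ n)); exact: der_Re_cexp.
have := taylor2 (fun t _ => D 0%N t) (fun t _ => D 1%N t) (fun t _ => D 2%N t)
  (fun t ht => cexp_line_bound w ht z1 3).
apply: le_trans; apply: le_trans (ler_norm _).
rewrite mul1r mul0r cexp0 expr0 expr1 !mulr1.
have -> : complex.Re (zeta * w ^+ 2) / 2 = complex.Re (zeta * (w ^+ 2 / 2)).
  have -> : w ^+ 2 / 2 = (2^-1)%:C * w ^+ 2 by rewrite fmorphV rmorph_nat mulrC.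
  by case: zeta {z1 D} => a b; case: (w ^+ 2) => c d; simpc => /=; field.
by rewrite !mulrBr mulr1 !raddfB.
Qed.

Lemma jet2_cexp (g : R[i] -> R[i]) z : jet2 g z -> jet2 (fun z => cexp (g z)) z.
Proof.
move=> J; have O1 := jet2_Oh1 J; move: J => [a [b H]].
exists (cexp (g z) * a), (cexp (g z) * (b + a ^+ 2 / 2)).
pose u h := g (z + h) - g z; pose r h := u h - a * h - b * h ^+ 2.
(* the cubic remainder of exp, composed with the increment u = O(h) *)
have X : Oh 3 (fun h => cexp (u h) - 1 - u h - u h ^+ 2 / 2).
  have [C [s [C0 s0 K]]] := O1; exists (C ^+ 3 * expR (C * s)), s.
  split; rewrite ?mulr_ge0 ?exprn_ge0 ?expR_ge0// => h hs.
  apply: le_trans (cexp_taylor2 _) _.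
  have uC : normc (u h) <= C * normc h by have := K _ hs; rewrite expr1.
  rewrite [leRHS]mulrAC -exprMn ler_pM ?exprn_ge0 ?normc_ge0 ?expR_ge0//.
    by rewrite lerXn2r ?nnegrE ?mulr_ge0 ?normc_ge0.
  by rewrite ler_expR (le_trans uC)// ler_wpM2l.
have Y : Oh 3 (fun h => (u h + a * h) * (b * h ^+ 2 + r h) / 2).
  apply: (@Oh_ext _ _ (fun h => 2^-1 * ((u h + a * h) * (b * h ^+ 2 + r h)))).
    by move=> h; rewrite mulrC.
  apply: OhZ; apply: (@OhM _ 1 2).
    by apply: OhD => //; exact: OhZ Oh_id.
  by apply: OhD; [exact: OhZ (OhXn 2)|exact: OhW H].
apply: Oh_ext (OhZ (cexp (g z)) (OhD (OhD X Y) H)) => h.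
have -> : cexp (g (z + h)) = cexp (g z) * cexp (u h).
  by rewrite -cexpD; congr cexp; rewrite /u; ring.
by rewrite /r /u; field.
Qed.

End ComplexExponential.

(** * Maximum principle and two-constants theorem *)

Section MaximumPrinciple.
Context {R : realType}.
Implicit Types (g : R[i] -> R[i]) (a b c d x y : R).

Lemma jet2_continuous_Re g (zeta : R[i]) x y :
  normc zeta <= 1 -> jet2 g (x +i* y) ->
  {for (x, y), continuous (fun q : R * R => complex.Re (zeta * g (q.1 +i* q.2)))}.
Proof.
move=> z1 /jet2_Oh1 [C [r [C0 r0 H]]].
apply/cvgrPdist_le => /= e e0.
pose s := Num.min (r / 2) (e / (2 * (C + 1))).
have C1 : 0 < C + 1 by lra.
have s0 : 0 < s by rewrite lt_min !divr_gt0// mulr_gt0.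
exists (ball x s, ball y s) => /=; first by split; exact: nbhsx_ballx.
move=> [x' y'] [/= xx yy].
have hn : normc ((x' - x) +i* (y' - y)) <= 2 * s.
  apply: le_trans (normc_le_ReIm _) _ => /=.
  by rewrite mulr_natl mulr2n lerD// distrC ltW.
rewrite -raddfB -mulrBr; apply: le_trans (Re_normc _) _.
rewrite Normc.normcM normc_distC.
apply: le_trans (ler_wpM2r (normc_ge0 _) z1) _; rewrite mul1r.
have := H ((x' - x) +i* (y' - y)).
have -> : x +i* y + ((x' - x) +i* (y' - y)) = x' +i* y'.
  by simpc; rewrite !(addrC _ (_ - _)) !subrK.
have [sr se] : s <= r / 2 /\ s <= e / (2 * (C + 1)).
  by rewrite /s !ge_min !lexx orbT.
move=> /(_ (le_trans hn _)) K; apply: le_trans (K _) _; first lra.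
rewrite expr1; apply: le_trans (ler_wpM2l C0 hn) _.
have : s * (2 * (C + 1)) <= e by rewrite -ler_pdivlMr ?mulr_gt0.
nra.
Qed.

(** The mean of Re (zeta g) over z + s, z - s, z + is, z - is differs from its
    value at z by O(s^3), because both the sum of the increments and the sum of
    their squares vanish, whereas the convex term gains a multiple of s^2. *)
Lemma jet2_no_strict_max g (zeta : R[i]) (delta x0 x y : R) :
  normc zeta <= 1 -> jet2 g (x +i* y) -> 0 < delta ->
  let u (s t : R) := complex.Re (zeta * g (s +i* t)) + delta * (s - x0) ^+ 2 in
  forall m, 0 < m ->
  exists s, [/\ 0 < s, s < m & 4 * u x y <
    u (x + s) y + u (x - s) y + u x (y + s) + u x (y - s)].
Proof.
move=> z1 [a [b [C [r [C0 r0 H]]]]] de0 u m m0.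
pose s := Num.min (m / 2) (Num.min r (delta / (2 * (C + 1)) / 2)).
have C1 : 0 < C + 1 by lra.
have q0 : 0 < delta / (2 * (C + 1)) by rewrite divr_gt0// mulr_gt0.
have s0 : 0 < s by rewrite !lt_min; apply/and3P; split=> //; exact: divr_gt0.
have [sm sr sd] : [/\ s <= m / 2, s <= r & s <= delta / (2 * (C + 1)) / 2].
  by rewrite /s !ge_min !lexx !orbT.
exists s; split => //; first lra.
pose z := x +i* y; pose E h := g (z + h) - g z - a * h - b * h ^+ 2.
have EB h : normc h = s -> - (C * s ^+ 3) <= complex.Re (zeta * E h).
  move=> hs; have := H h; rewrite hs => /(_ sr) K.
  rewrite lerNl; apply: le_trans K; apply: le_trans (ler_norm _) _.
  rewrite normrN; apply: le_trans (Re_normc _) _.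
  by rewrite Normc.normcM ler_piMl// normc_ge0.
have n1 : normc (s%:C : R[i]) = s by rewrite normc_real gtr0_norm.
have n2 : normc ('i * s%:C : R[i]) = s.
  by rewrite Normc.normcM n1 /= expr0n expr1n add0r sqrtr1 mul1r.
have B1 := EB _ n1; have B2 := EB (- s%:C); have B3 := EB _ n2.
have B4 := EB (- ('i * s%:C)).
rewrite !normcN in B2 B4; have {}B2 := B2 n1; have {}B4 := B4 n2.
have i2 : 'i ^+ 2 = -1 :> R[i] by rewrite sqr_i.
have S : g ((x + s) +i* y) + g ((x - s) +i* y) + g (x +i* (y + s))
    + g (x +i* (y - s)) - 4 * g z =
    E s%:C + E (- s%:C) + E ('i * s%:C) + E (- ('i * s%:C)).
  rewrite /E.
  have -> : (x + s) +i* y = z + s%:C by rewrite /z; simpc.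
  have -> : (x - s) +i* y = z + - s%:C by rewrite /z; simpc.
  have -> : x +i* (y + s) = z + 'i * s%:C by rewrite /z; simpc.
  have -> : x +i* (y - s) = z + - ('i * s%:C) by rewrite /z; simpc.
  by ring: i2.
clearbody E.
have {}S := congr1 (fun w => complex.Re (zeta * w)) S.
rewrite /= mulrBr !mulrDr raddfB !raddfD /= in S.
have R4 : complex.Re (zeta * (4 * g z)) = 4 * complex.Re (zeta * g z).
  rewrite mulrCA -(rmorph_nat (real_complex R)) /=.
  by case: (zeta * g z) => p q; simpc.
rewrite R4 in S.
rewrite /u -/z.
have sC : s * (2 * (C + 1)) <= delta / 2 by rewrite -ler_pdivlMr ?mulr_gt0// mulrAC.
have : 4 * (C * s ^+ 3) < 2 * delta * s ^+ 2.
  rewrite (_ : 4 * (C * s ^+ 3) = (4 * C * s) * s ^+ 2); last by ring.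
  by rewrite ltr_pM2r ?exprn_gt0//; nra.
have -> : delta * (x + s - x0) ^+ 2 =
  delta * (x - x0) ^+ 2 + delta * s ^+ 2 + 2 * delta * s * (x - x0) by ring.
have -> : delta * (x - s - x0) ^+ 2 =
  delta * (x - x0) ^+ 2 + delta * s ^+ 2 - 2 * delta * s * (x - x0) by ring.
lra.
Qed.

(** The modulus at a given point is the value there of the harmonic function
    Re (zeta g) for a suitable zeta; a small multiple of (x - a)^2 is added to
    exclude interior maxima. *)
Lemma maximum_principle g a b c d (P : R) :
  (forall x y, a <= x <= b -> c <= y <= d -> jet2 g (x +i* y)) ->
  (forall x y, a <= x <= b -> c <= y <= d ->
     [|| x == a, x == b, y == c | y == d] -> normc (g (x +i* y)) <= P) ->
  forall x y, a <= x <= b -> c <= y <= d -> normc (g (x +i* y)) <= P.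
Proof.
move=> J B x y hx hy; apply: normc_le_dual => zeta z1.
apply/ler_addgt0Pr => e e0.
have ba : 0 < (b - a) ^+ 2 + 1 by have := sqr_ge0 (b - a); lra.
pose delta := e / ((b - a) ^+ 2 + 1).
have de0 : 0 < delta by rewrite divr_gt0.
have deE : delta * (b - a) ^+ 2 <= e.
  by rewrite /delta mulrAC ler_pdivrMr// ler_pM2l//; lra.
pose u (q : R * R) := complex.Re (zeta * g (q.1 +i* q.2)) + delta * (q.1 - a) ^+ 2.
pose A : set (R * R) := `[a, b]%classic `*` `[c, d]%classic.
have cu : {within A, continuous u}.
  apply: continuous_in_subspaceT => -[s t]; rewrite inE => -[/=].
  rewrite !in_itv /= => hs ht.
  apply: cvgD; first exact: (jet2_continuous_Re z1 (J _ _ hs ht)).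
  apply: (@continuous_comp _ _ _ fst (fun s => delta * (s - a) ^+ 2)).
    exact: cvg_fst.
  by apply: der_continuous (derMl _ _).
have cA : compact A by apply: compact_setX; exact: segment_compact.
have A0 : A !=set0 by exists (x, y); split => /=; rewrite in_itv.
have [[s t] + M] := compact_EVT_max A0 cA cu.
rewrite inE => -[/=]; rewrite !in_itv /= => hs ht.
have {}M s' t' : a <= s' <= b -> c <= t' <= d -> u (s', t') <= u (s, t).
  by move=> h h'; apply: M; rewrite inE; split => /=; rewrite in_itv.
have uxy : complex.Re (zeta * g (x +i* y)) <= u (s, t).
  apply: le_trans (M _ _ hx hy).
  by rewrite /u /= lerDl mulr_ge0 ?sqr_ge0// ltW.
apply: le_trans uxy _.
case: (boolP [|| s == a, s == b, t == c | t == d]) => [bd|].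
  rewrite /u /= lerD//.
    by apply: le_trans (Re_dual_le _ z1) (B _ _ hs ht bd).
  apply: le_trans deE; rewrite ler_pM2l// lerXn2r ?nnegrE; lra.
rewrite !negb_or => /and4P[sa sb tc td]; exfalso.
have {hs}[as_ sb_] : a < s /\ s < b.
  by move: hs; rewrite !le_eqVlt (eq_sym a) (negbTE sa) (negbTE sb) => /andP.
have {ht}[ct_ td_] : c < t /\ t < d.
  by move: ht; rewrite !le_eqVlt (eq_sym c) (negbTE tc) (negbTE td) => /andP.
pose m := Num.min (Num.min (s - a) (b - s)) (Num.min (t - c) (d - t)).
have m0 : 0 < m by rewrite !lt_min; apply/andP; split; apply/andP; split; lra.
have Jst : jet2 g (s +i* t) by apply: J; apply/andP; split; lra.
have [h [h0]] := jet2_no_strict_max a z1 Jst de0 m0.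
rewrite !lt_min => /andP[/andP[h1 h2] /andP[h3 h4]].
have [r1 r2 r3 r4] : [/\ a <= s + h <= b, a <= s - h <= b,
    c <= t + h <= d & c <= t - h <= d].
  by split; apply/andP; split; lra.
have M1 := M (s + h) t; have M2 := M (s - h) t.
have M3 := M s (t + h); have M4 := M s (t - h).
have st_in : a <= s <= b /\ c <= t <= d by split; apply/andP; split; lra.
have {}M1 := M1 r1 st_in.2; have {}M2 := M2 r2 st_in.2.
have {}M3 := M3 st_in.1 r3; have {}M4 := M4 st_in.1 r4.
rewrite /u /= in M1 M2 M3 M4; lra.
Qed.

End MaximumPrinciple.

Section TwoConstants.
Context {R : realType}.
Implicit Types (g : R[i] -> R[i]) (x y t d k X P eta : R).

(** The rectangle has its clean side at height y0 and its good side, where g is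
    smaller by the factor eta, at height y0 + d; d may be negative.  With
    w = (z - x0 - i y0) / d = s + it and L = - ln eta, the maximum principle is
    applied to g exp(L phi) for phi = (- i w - k w^2) / (1 + k).  Indeed
    Re phi = (t + k t^2 - k s^2) / (1 + k) is at most 1 on the good side, at
    most 0 on the clean side and, as X^2 / d^2 >= (1 + k) / k, also at most 0 on
    the vertical sides; above x0 it is at least t / (1 + k). *)
Lemma two_constants g x0 y0 d X k P eta :
  d != 0 -> 0 < k -> 0 <= X -> d ^+ 2 * (1 + k) <= k * X ^+ 2 ->
  0 < eta <= 1 ->
  (forall x t, x0 - X <= x <= x0 + X -> 0 <= t <= 1 ->
     jet2 g (x +i* (y0 + t * d)) /\ normc (g (x +i* (y0 + t * d))) <= P) ->
  (forall x, x0 - X <= x <= x0 + X -> normc (g (x +i* (y0 + d))) <= P * eta) ->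
  forall t, 0 <= t <= 1 ->
    normc (g (x0 +i* (y0 + t * d))) <= P * eta `^ (t / (1 + k)).
Proof.
move=> d0 k0 X0 dX /andP[e0 e1] JB S t ht.
have hx0 : x0 - X <= x0 <= x0 + X by apply/andP; split; lra.
have P0 : 0 <= P by apply: le_trans (normc_ge0 _) (JB _ _ hx0 ht).2.
have k1 : 0 < 1 + k by lra.
pose L := - ln eta.
have L0 : 0 <= L by rewrite oppr_ge0 ln_le0.
have eL : expR L = eta^-1 by rewrite expRN lnK.
pose w z := (z - (x0 +i* y0)) * (d^-1)%:C.
pose phi z := (L / (1 + k))%:C * (- ('i * w z) - k%:C * (w z * w z)).
have Jphi z : jet2 phi z.
  have Jw : jet2 w z.
    by apply: jet2M (jet2_cst _ _); exact: jet2D (jet2_id z) (jet2_cst _ _).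
  apply: jet2M (jet2_cst _ _) _; apply: jet2D; apply: jet2N.
    exact: jet2M (jet2_cst _ _) Jw.
  exact: jet2M (jet2_cst _ _) (jet2M Jw Jw).
have Rphi x s : complex.Re (phi (x +i* (y0 + s * d))) =
    L * ((s + k * s ^+ 2 - k * ((x - x0) / d) ^+ 2) / (1 + k)).
  have -> : phi (x +i* (y0 + s * d)) = (L / (1 + k))%:C *
      (- ('i * (((x - x0) / d) +i* s)) -
      k%:C * ((((x - x0) / d) +i* s) * (((x - x0) / d) +i* s))).
    congr (_ * _); rewrite /phi /w.
    suff -> : (x +i* (y0 + s * d) - (x0 +i* y0)) * (d^-1)%:C =
      ((x - x0) / d) +i* s by [].
    by simpc; congr (_ +i* _); field.
  by simpc => /=; field; rewrite gt_eqF.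
pose G z := g z * cexp (phi z).
have GE z : normc (G z) = normc (g z) * expR (complex.Re (phi z)).
  by rewrite Normc.normcM normc_cexp.
have bd (s v Q : R) : 0 <= v -> 0 <= Q -> v <= P * Q -> Q * expR s <= 1 ->
    v * expR s <= P.
  move=> v0 Q0 vP Qs; apply: le_trans (ler_wpM2r (expR_ge0 _) vP) _.
  by rewrite -mulrA ler_piMr.
have tD y : Num.min y0 (y0 + d) <= y <= Num.max y0 (y0 + d) ->
    0 <= (y - y0) / d <= 1.
  have [dn|dp] : d < 0 \/ 0 < d by move: d0; rewrite neq_lt => /orP.
    rewrite min_r ?max_l; [|lra|lra] => /andP[h1 h2].
    by rewrite ler_ndivlMr// ler_ndivrMr//; lra.
  rewrite min_l ?max_r; [|lra|lra] => /andP[h1 h2].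
  by rewrite ler_pdivlMr// ler_pdivrMr//; lra.
have yE y : y = y0 + ((y - y0) / d) * d by rewrite divfK// addrC subrK.
have yD : Num.min y0 (y0 + d) <= y0 + t * d <= Num.max y0 (y0 + d).
  move: ht => /andP[t0 t1].
  have [dn|dp] : d < 0 \/ 0 < d by move: d0; rewrite neq_lt => /orP.
    by rewrite min_r ?max_l; [apply/andP; split; nra|lra|lra].
  by rewrite min_l ?max_r; [apply/andP; split; nra|lra|lra].
suff : normc (G (x0 +i* (y0 + t * d))) <= P.
  rewrite GE Rphi subrr mul0r expr0n mulr0 subr0.
  rewrite -ler_pdivlMr ?expR_gt0// -expRN => /le_trans; apply.
  rewrite ler_wpM2l// /powR gt_eqF// ler_expR /L mulNr opprK.
  rewrite [leLHS]mulrC.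
  apply: ler_wnM2r; first by rewrite ln_le0.
  rewrite ler_pM2r ?invr_gt0// lerDl mulr_ge0 ?sqr_ge0 ?ltW//.
apply: maximum_principle hx0 yD.
- move=> x y hx /tD hy; rewrite (yE y).
  by apply: jet2M; [exact: (JB _ _ hx hy).1|exact: jet2_cexp].
- move=> x y hx /tD hs bdy.
  have : [|| x == x0 - X, x == x0 + X, y == y0 | y == y0 + d].
    move: bdy; rewrite /Num.max /Num.min; case: ifP => _ //.
    by rewrite [(y == _) || _]orbC.
  move=> {}bdy; set s := (y - y0) / d in hs.
  have ys : y = y0 + s * d by exact: yE.
  rewrite ys.
  have hgP := (JB _ _ hx hs).2.
  rewrite GE Rphi.
  have sq (v : R) : 0 <= k * (v / d) ^+ 2 by rewrite mulr_ge0 ?sqr_ge0// ltW.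
  have side : x = x0 - X \/ x = x0 + X -> 1 + k <= k * ((x - x0) / d) ^+ 2.
    move=> xX; have -> : ((x - x0) / d) ^+ 2 = X ^+ 2 / d ^+ 2.
      by case: xX => ->; field.
    by rewrite mulrA ler_pdivlMr ?exprn_even_gt0// mulrC.
  have /andP[s_ge0 s_le1] := hs.
  have s2 : s ^+ 2 <= 1 by rewrite expr_le1.
  have le0 (v : R) : v <= 0 -> expR (L * (v / (1 + k))) <= 1.
    move=> v0; rewrite expR_le1 mulr_ge0_le0//.
    by rewrite mulr_le0_ge0// invr_ge0 ltW.
  have sides : x = x0 - X \/ x = x0 + X -> normc (g (x +i* (y0 + s * d))) *
      expR (L * ((s + k * s ^+ 2 - k * ((x - x0) / d) ^+ 2) / (1 + k))) <= P.
    move=> /side xX; apply: (bd _ _ 1); rewrite ?normc_ge0 ?mulr1 ?mul1r//.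
    by apply: le0; nra.
  case/or4P: bdy => [/eqP xX|/eqP xX|/eqP yy|/eqP yy].
  + by apply: sides; left.
  + by apply: sides; right.
  + have -> : s = 0 by rewrite /s yy subrr mul0r.
    apply: (bd _ _ 1); rewrite ?normc_ge0 ?mulr1 ?mul1r//.
      have := (JB x 0 hx); rewrite lexx ler01 => /(_ isT)[].
      by rewrite mul0r addr0.
    by apply: le0; rewrite expr0n mulr0 !add0r oppr_le0.
  + have -> : s = 1 by rewrite /s yy addrAC subrr add0r mulfV.
    apply: (bd _ _ eta); rewrite ?normc_ge0 ?(ltW e0) ?mul1r//; first exact: S.
    rewrite -ler_pdivlMl// mulr1 -eL ler_expR expr1n mulr1.
    rewrite ler_piMr// ler_pdivrMr// mul1r gerBl; exact: sq.
Qed.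

(** Phragmen-Lindelof for bounded functions.  For every theta < 1, a large
    enough rectangle standing on the line bounds |g| by P (B / P)^theta; theta
    tends to 1. *)
Lemma half_plane_bound g y P B :
  (forall x s, y <= s -> jet2 g (x +i* s) /\ normc (g (x +i* s)) <= P) ->
  (forall x, normc (g (x +i* y)) <= B) ->
  forall x s, y <= s -> normc (g (x +i* s)) <= B.
Proof.
move=> JP HB x s ys.
apply/ler_addgt0Pr => e e0; set B' := B + e.
have B0 : 0 <= B by apply: le_trans (normc_ge0 _) (HB x).
have B'0 : 0 < B' by rewrite /B'; lra.
have HP := (JP x s ys).2.
rewrite leNgt; apply/negP => vB.
set v := normc (g (x +i* s)) in HP vB.
have P0 : 0 < P by lra.
pose eta := B' / P.
have eta0 : 0 < eta by rewrite divr_gt0.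
have eta1 : eta < 1 by rewrite ltr_pdivrMr// mul1r; lra.
have L0 : 0 < - ln eta by rewrite oppr_gt0 ln_lt0// eta0.
have l0 : 0 < ln (v / B') by rewrite ln_gt0// ltr_pdivlMr// mul1r.
have lL : ln (v / B') <= - ln eta.
  rewrite -lnV ?posrE// ler_ln ?posrE ?divr_gt0 ?invr_gt0//; last lra.
  by rewrite invf_div ler_pM2r ?invr_gt0.
(* If v > B', the exponent theta = 1 - dl already contradicts the bound: the
   factor eta^(- dl) is only the square root of v / B'. *)
pose dl := ln (v / B') / (- ln eta) / 2.
have dl0 : 0 < dl by rewrite !divr_gt0.
have dl1 : dl <= 1 / 2.
  by rewrite /dl ler_pM2r ?invr_gt0// ler_pdivrMr// mul1r.
pose theta := 1 - dl.
have th0 : 0 < theta by rewrite /theta; lra.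
pose T := 2 * (s - y) / dl + 1.
have T0 : 0 < T by rewrite /T; have : 0 <= 2 * (s - y) / dl;
  [rewrite !mulr_ge0 ?invr_ge0 ?(ltW dl0)//; lra|lra].
pose k := dl / (2 * theta).
have k0 : 0 < k by rewrite divr_gt0// mulr_gt0.
have k1 : 0 < 1 + k by lra.
pose t := 1 - (s - y) / T.
have tT : (s - y) / T <= dl / 2.
  rewrite ler_pdivrMr// /T mulrDr.
  have -> : dl / 2 * (2 * (s - y) / dl) = s - y by field; rewrite gt_eqF.
  lra.
have tT0 : 0 <= (s - y) / T by rewrite divr_ge0 ?(ltW T0)//; lra.
have ht : 0 <= t <= 1 by apply/andP; rewrite /t; split; lra.
have := @two_constants g x (y + T) (- T) (T * (1 + k) / k) k P eta.
have dX : (- T) ^+ 2 * (1 + k) <= k * (T * (1 + k) / k) ^+ 2.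
  have -> : k * (T * (1 + k) / k) ^+ 2 = T ^+ 2 * ((1 + k) * ((1 + k) / k)).
    by field; rewrite gt_eqF.
  rewrite sqrrN ler_pM2l ?exprn_gt0// ler_peMr ?(ltW k1)//.
  by rewrite ler_pdivlMr// mul1r; lra.
have e1 : 0 < eta <= 1 by rewrite eta0 ltW.
have X0 : 0 <= T * (1 + k) / k by apply/ltW/divr_gt0 => //; exact: mulr_gt0.
rewrite oppr_eq0 gt_eqF// => /(_ isT k0 X0 dX e1).
have JP' x' t' : x - T * (1 + k) / k <= x' <= x + T * (1 + k) / k ->
  0 <= t' <= 1 -> jet2 g (x' +i* (y + T + t' * - T)) /\
    normc (g (x' +i* (y + T + t' * - T))) <= P.
  by move=> _ /andP[t0 t1]; apply: JP; nra.
have HB' x' : x - T * (1 + k) / k <= x' <= x + T * (1 + k) / k ->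
   normc (g (x' +i* (y + T + - T))) <= P * eta.
  move=> _; rewrite addrK /eta mulrC divfK ?gt_eqF//.
  by apply: le_trans (HB _) _; rewrite /B'; lra.
move=> /(_ JP' HB' t ht).
have -> : y + T + t * - T = s by rewrite /t; field; rewrite gt_eqF.
rewrite -/v /powR gt_eqF// => vle.
have {}vle : v <= P * expR (theta * ln eta).
  apply: le_trans vle _; rewrite ler_pM2l// ler_expR.
  rewrite ler_wnM2r ?ln_le0 ?(ltW eta1)// ler_pdivlMr//.
  have -> : theta * (1 + k) = 1 - dl / 2.
    by rewrite /k /theta; field; rewrite gt_eqF.
  by rewrite /t; lra.
have vE : P * expR (theta * ln eta) = B' * expR (ln (v / B') / 2).
  have -> : theta * ln eta = ln eta + ln (v / B') / 2.
    by rewrite /theta /dl; field; rewrite lt_eqF// ln_lt0// eta0.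
  rewrite expRD lnK ?posrE// /eta mulrA (mulrC P) divfK// gt_eqF//.
have : v / B' <= expR (ln (v / B') / 2) by rewrite ler_pdivrMr// mulrC -vE.
rewrite -{1}(@lnK _ (v / B')) ?posrE ?divr_gt0//; last lra.
by rewrite ler_expR; lra.
Qed.


End TwoConstants.

(** * Stability for two holomorphic functions *)

Section StabilityCore.
Context {R : realType}.
Implicit Types (F : R[i] -> R[i]) (x y h L eps c : R).

(** Multiplying the cross product by u^* makes both products u u'^* and v v'^*,
    and the difference of the squared moduli, appear. *)
Lemma cross_product_bound (u u' v v' : R[i]) :
  normc u * normc (u' * v - v' * u) <=
  normc (u * conjc u' - v * conjc v') * normc v +
  `|normc u ^+ 2 - normc v ^+ 2| * normc v'.
Proof.
have nn (z : R[i]) : conjc z * z = (normc z ^+ 2)%:C.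
  by case: z => p q; rewrite normcE2; simpc; congr (_ +i* _); ring.
have E : conjc u * (u' * v - v' * u) =
    conjc (u * conjc u' - v * conjc v') * v - (normc u ^+ 2 - normc v ^+ 2)%:C * v'.
  have -> : (normc u ^+ 2 - normc v ^+ 2)%:C = conjc u * u - conjc v * v.
    by rewrite !nn -rmorphB.
  by rewrite rmorphB !rmorphM /= !conjcK; ring.
rewrite -{1}(normc_conj u) -Normc.normcM E; apply: le_trans (normcB _ _) _.
by rewrite !Normc.normcM normc_conj normc_real.
Qed.

(** Dividing the previous bound by the larger of |u| and |v| loses no constant on
    the first term; on the second one, |u| >= sqrt eps B is enough to turn eps
    into sqrt eps, without any power of 1 / c. *)
Lemma cross_product_bound_max (u u' v v' : R[i]) (eps c B B' Q : R) :
  0 < eps < 1 -> eps <= c -> 0 < B -> 0 <= Q -> normc u' <= B' -> normc v' <= B' ->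
  B * B' <= Q ->
  c * B ^+ 2 <= normc u ^+ 2 -> c * B ^+ 2 <= normc v ^+ 2 ->
  `|normc u ^+ 2 - normc v ^+ 2| <= eps * B ^+ 2 ->
  normc (u' * v - v' * u) <= normc (u * conjc u' - v * conjc v') + Q * Num.sqrt eps.
Proof.
move=> /andP[e0 e1] ec B0 Q0.
wlog uv : u u' v v' / normc v <= normc u.
  move=> W uB vB QB cu cv D; have [|vu] := leP (normc v) (normc u).
    by move=> uv; apply: W.
  have := W v v' u u' (ltW vu) vB uB QB cv cu.
  rewrite distrC => /(_ D); rewrite normc_distC => /le_trans; apply.
  by rewrite normc_distC.
move=> uB vB QB cu cv D.
pose s := Num.sqrt eps; have s0 : 0 < s by rewrite sqrtr_gt0.
have s2 : s ^+ 2 = eps by rewrite sqr_sqrtr// ltW.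
have su : s * B <= normc u.
  have : (s * B) ^+ 2 <= normc u ^+ 2.
    by apply: le_trans cu; rewrite exprMn s2 ler_pM2r// exprn_gt0.
  by rewrite ler_pXn2r// nnegrE ?normc_ge0// mulr_ge0// ltW.
have u0 : 0 < normc u by apply: lt_le_trans su; exact: mulr_gt0.
rewrite -(ler_pM2l u0); apply: le_trans (cross_product_bound u u' v v') _.
rewrite mulrDr lerD//; first by rewrite mulrC ler_wpM2r ?normc_ge0.
have B'0 : 0 <= B' by apply: le_trans (normc_ge0 _) vB.
apply: (@le_trans _ _ ((s * B) * (B * B' * s))).
  have -> : s * B * (B * B' * s) = eps * B ^+ 2 * B' by rewrite -s2; ring.
  by rewrite ler_pM ?normc_ge0.
by rewrite ler_pM ?mulr_ge0 ?(ltW s0) ?(ltW B0)// ler_wpM2r// ltW.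
Qed.

Lemma powR_le_exp eps (a b : R) : 0 < eps < 1 -> b <= a -> eps `^ a <= eps `^ b.
Proof. by move=> /andP[e0 e1]; apply: ger_powR; rewrite e0 ltW. Qed.

(** The number 106 is the sum of the half-widths 6 and 100 of the two rectangles,
    in units of h. *)
Lemma ratio_stability F1 F2 (h L eps c Bm B1 B2 : R) :
  0 < h -> 0 < eps < 1 -> 0 < c -> eps <= c -> 0 < B2 -> B2 <= B1 -> B1 <= Bm ->
  (forall x y, 0 < y -> jet2 F1 (x +i* y) /\ jet2 F2 (x +i* y)) ->
  (forall x y, h / 2 <= y ->
     normc (F1 (x +i* y)) <= Bm /\ normc (F2 (x +i* y)) <= Bm) ->
  (forall x y, h <= y ->
     normc (F1 (x +i* y)) <= B1 /\ normc (F2 (x +i* y)) <= B1) ->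
  (forall x y, 2 * h <= y ->
     normc (F1 (x +i* y)) <= B2 /\ normc (F2 (x +i* y)) <= B2) ->
  (forall x, - L <= x <= L ->
    [/\ `|normc (F1 (x +i* h)) ^+ 2 - normc (F2 (x +i* h)) ^+ 2|
          <= eps * B1 ^+ 2,
        `|normc (F1 (x +i* (2 * h))) ^+ 2 - normc (F2 (x +i* (2 * h))) ^+ 2|
          <= eps * B2 ^+ 2,
        c * B1 ^+ 2 <= normc (F1 (x +i* h)) ^+ 2 /\
        c * B1 ^+ 2 <= normc (F2 (x +i* h)) ^+ 2 &
        c * B2 ^+ 2 <= normc (F1 (x +i* (2 * h))) ^+ 2 /\
        c * B2 ^+ 2 <= normc (F2 (x +i* (2 * h))) ^+ 2]) ->
  forall x, - (L - 106 * h) <= x <= L - 106 * h ->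
  normc (F1 (x +i* (4 * h)) / F1 (x +i* (2 * h)) -
         F2 (x +i* (4 * h)) / F2 (x +i* (2 * h)))
  <= 3 / c * (Bm / B2) * eps `^ (4 / 15).
Proof.
move=> h0 e01 c0 ec B20 B21 B1m J HBm HB1 HB2 Hyp x0 /andP[x0l x0r].
have /andP[e0 e1] := e01.
have B10 : 0 < B1 by lra.
have Bm0 : 0 < Bm by lra.
pose P := 2 * (Bm * B2).
pose H z := F1 z * conjc (F1 (conjc z + (0 +i* (4 * h)))) -
            F2 z * conjc (F2 (conjc z + (0 +i* (4 * h)))).
have refl x y : conjc (x +i* y) + (0 +i* (4 * h)) = x +i* (4 * h - y) :> R[i].
  by simpc; rewrite ?addr0 addrC.
have step1 x : - (L - 6 * h) <= x <= L - 6 * h ->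
    normc (H (x +i* h)) <= P * eps `^ (3 / 10).
  move=> /andP[xl xr].
  (* Width: d = 3h/2 and k = 1/9 require X >= sqrt(45/2) h; exponent:
     (1/3) / (1 + 1/9) = 3/10. *)
  have := @two_constants R H x (h / 2) (3 / 2 * h) (6 * h) (1 / 9) P eps.
  have d0 : 3 / 2 * h != 0 by rewrite mulf_neq0// ?gt_eqF//; lra.
  have k0 : 0 < 1 / 9 :> R by lra.
  have X0 : 0 <= 6 * h by lra.
  have dX : (3 / 2 * h) ^+ 2 * (1 + 1 / 9) <= 1 / 9 * (6 * h) ^+ 2 by nra.
  have e1' : 0 < eps <= 1 by rewrite e0 ltW.
  move=> /(_ d0 k0 X0 dX e1').
  have JB x' t : x - 6 * h <= x' <= x + 6 * h -> 0 <= t <= 1 ->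
      jet2 H (x' +i* (h / 2 + t * (3 / 2 * h))) /\
      normc (H (x' +i* (h / 2 + t * (3 / 2 * h)))) <= P.
    move=> _ /andP[t0 t1]; set y := h / 2 + _.
    have y0 : h / 2 <= y by rewrite /y; nra.
    have y2 : 2 * h <= 4 * h - y by rewrite /y; nra.
    have yp : 0 < y by lra.
    have yp' : 0 < 4 * h - y by lra.
    have [j1 j2] := J x' _ yp; have [j3 j4] := J x' _ yp'.
    rewrite -refl in j3 j4; split.
      apply: jet2D; last apply: jet2N; apply: jet2M => //; exact: jet2_reflect.
    rewrite /H !refl; apply: le_trans (normcB _ _) _.
    rewrite !Normc.normcM !normc_conj.
    have [? ?] := HBm x' _ y0; have [? ?] := HB2 x' _ y2.
    have -> : P = Bm * B2 + Bm * B2 by rewrite /P; ring.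
    by rewrite lerD// ler_pM ?normc_ge0.
  have S x' : x - 6 * h <= x' <= x + 6 * h ->
      normc (H (x' +i* (h / 2 + 3 / 2 * h))) <= P * eps.
    move=> /andP[xl' xr'].
    have -> : h / 2 + 3 / 2 * h = 2 * h by field.
    rewrite /H refl (_ : 4 * h - 2 * h = 2 * h); last by ring.
    have nn (z : R[i]) : z * conjc z = (normc z ^+ 2)%:C.
      by case: z => p q; rewrite normcE2; simpc; congr (_ +i* _); ring.
    rewrite !nn -rmorphB normc_real.
    have [|_ K _ _] := Hyp x'; first by apply/andP; split; lra.
    apply: le_trans K _; rewrite mulrC ler_pM2r// /P expr2 mulrA ler_pM2r//.
    lra.
  move=> /(_ JB S (1 / 3)).
  rewrite (_ : h / 2 + 1 / 3 * (3 / 2 * h) = h); last by field.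
  rewrite (_ : 1 / 3 / (1 + 1 / 9) = 3 / 10 :> R); last by field.
  by apply; apply/andP; split; lra.
pose K z := F1 (z + (0 +i* (2 * h))) * F2 z - F2 (z + (0 +i* (2 * h))) * F1 z.
have shift x y : (x +i* y) + (0 +i* (2 * h)) = x +i* (y + 2 * h) :> R[i].
  by simpc; rewrite ?addr0.
pose Q := 3 * (Bm * B2).
have step2 x : - (L - 6 * h) <= x <= L - 6 * h ->
    normc (K (x +i* h)) <= Q * eps `^ (3 / 10).
  move=> hx; have /andP[xl xr] := hx.
  have [|D _ [c1 c2] _] := Hyp x; first by apply/andP; split; lra.
  rewrite /K shift.
  have := step1 _ hx; rewrite /H refl (_ : 4 * h - h = h + 2 * h); last by ring.
  have [|u1 u2] := HB2 x (h + 2 * h); first by lra.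
  have QB : B1 * B2 <= Bm * B2 by rewrite ler_pM2r.
  have Q0 : 0 <= Bm * B2 by apply/ltW/mulr_gt0.
  have := cross_product_bound_max e01 ec B10 Q0 u1 u2 QB c1 c2 D.
  have : Num.sqrt eps <= eps `^ (3 / 10).
    by rewrite -powR12_sqrt ?(ltW e0)//; apply: powR_le_exp => //; lra.
  move=> /(ler_wpM2l Q0); rewrite /Q /P; lra.
have e3 : 0 < eps `^ (3 / 10) <= 1.
  by rewrite powR_gt0//= -[leRHS](powRr0 eps); apply: powR_le_exp => //; lra.
have step3 : normc (K (x0 +i* (2 * h))) <= Q * eps `^ (4 / 15).
  (* Width: d = - 20h and k = 1/20 require X >= sqrt 8400 h; exponent:
     (19/20) / (1 + 1/20) = 19/21. *)
  have := @two_constants R K x0 (21 * h) (- (20 * h)) (100 * h) (1 / 20) Q _.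
  have d0 : - (20 * h) != 0 by rewrite oppr_eq0 gt_eqF//; lra.
  have k0 : 0 < 1 / 20 :> R by lra.
  have X0 : 0 <= 100 * h by lra.
  have dX : (- (20 * h)) ^+ 2 * (1 + 1 / 20) <= 1 / 20 * (100 * h) ^+ 2 by nra.
  move=> /(_ _ d0 k0 X0 dX e3).
  have JB x' t : x0 - 100 * h <= x' <= x0 + 100 * h -> 0 <= t <= 1 ->
      jet2 K (x' +i* (21 * h + t * - (20 * h))) /\
      normc (K (x' +i* (21 * h + t * - (20 * h)))) <= Q.
    move=> _ /andP[t0 t1]; set y := 21 * h + _.
    have y0 : h <= y by rewrite /y; nra.
    have y2 : 2 * h <= y + 2 * h by lra.
    have yp : 0 < y by lra.
    have yp' : 0 < y + 2 * h by lra.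
    have [j1 j2] := J x' _ yp; have [j3 j4] := J x' _ yp'.
    rewrite -shift in j3 j4; split.
      apply: jet2D; last apply: jet2N; apply: jet2M => //; exact: jet2_shift.
    rewrite /K !shift; apply: le_trans (normcB _ _) _.
    rewrite !Normc.normcM.
    have [b1 b2] := HB1 x' _ y0; have [b3 b4] := HB2 x' _ y2.
    apply: (@le_trans _ _ (B2 * B1 + B2 * B1)).
      by rewrite lerD// ler_pM ?normc_ge0.
    by rewrite /Q; nra.
  have S x' : x0 - 100 * h <= x' <= x0 + 100 * h ->
      normc (K (x' +i* (21 * h + - (20 * h)))) <= Q * eps `^ (3 / 10).
    move=> /andP[xl' xr'].
    rewrite (_ : 21 * h + - (20 * h) = h); last by ring.
    by apply: step2; apply/andP; split; lra.
  move=> /(_ JB S (19 / 20)).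
  rewrite (_ : 21 * h + 19 / 20 * - (20 * h) = 2 * h); last by field.
  rewrite (_ : 19 / 20 / (1 + 1 / 20) = 19 / 21 :> R); last by field.
  rewrite -powRrM => E; apply: le_trans (E _) _.
    by apply/andP; split; lra.
  rewrite ler_pM2l; last by rewrite /Q !mulr_gt0//; lra.
  by apply: powR_le_exp => //; lra.
have [|_ _ _ [c1 c2]] := Hyp x0; first by apply/andP; split; lra.
have pos F : c * B2 ^+ 2 <= normc (F (x0 +i* (2 * h))) ^+ 2 ->
    0 < normc (F (x0 +i* (2 * h))).
  move=> cF; rewrite lt_neqAle normc_ge0 andbT eq_sym; apply/eqP => n0.
  move: cF; rewrite n0 expr0n /= leNgt => /negP; apply.
  by rewrite mulr_gt0// exprn_gt0.
have p1 := pos _ c1; have p2 := pos _ c2.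
have n1 : F1 (x0 +i* (2 * h)) != 0 by rewrite -normc_eq0 gt_eqF.
have n2 : F2 (x0 +i* (2 * h)) != 0 by rewrite -normc_eq0 gt_eqF.
move: step3; rewrite /K shift (_ : 2 * h + 2 * h = 4 * h); last by ring.
move: n1 n2 c1 c2 p1 p2.
move: (F1 (x0 +i* (2 * h))) (F2 (x0 +i* (2 * h))) => u v.
move: (F1 (x0 +i* (4 * h))) (F2 (x0 +i* (4 * h))) => u' v'.
move=> n1 n2 c1 c2 p1 p2 K3.
have -> : u' / u - v' / v = (u' * v - v' * u) / (u * v).
  by field; rewrite n1 n2.
rewrite Normc.normcM Normc.normcV Normc.normcM.
have cB : 0 < c * B2 ^+ 2 by rewrite mulr_gt0// exprn_gt0.
have uv : c * B2 ^+ 2 <= normc u * normc v.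
  rewrite -(@ler_pXn2r _ 2) ?nnegrE ?(ltW cB) ?mulr_ge0 ?normc_ge0//.
  by rewrite [leRHS]exprMn [leLHS]expr2 ler_pM ?(ltW cB).
rewrite ler_pdivrMr ?mulr_gt0//; apply: le_trans K3 _.
have -> : Q * eps `^ (4 / 15) =
    3 / c * (Bm / B2) * eps `^ (4 / 15) * (c * B2 ^+ 2).
  by rewrite /Q; field; rewrite !gt_eqF.
rewrite ler_wpM2l// mulr_ge0 ?powR_ge0// ltW// !mulr_gt0 ?invr_gt0//.
Qed.

End StabilityCore.

(** * Integration of complex-valued functions *)

Section ComplexIntegral.
Context {R : realType}.
Local Notation mu := (@lebesgue_measure R).
Implicit Types (f g : R -> R[i]) (m : R -> R).

Definition cintegrable f :=
  mu.-integrable setT (EFin \o (fun x => complex.Re (f x))) /\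
  mu.-integrable setT (EFin \o (fun x => complex.Im (f x))).

Lemma cmeasurableD f g : cmeasurable f -> cmeasurable g ->
  cmeasurable (fun x => f x + g x).
Proof.
move=> [f1 f2] [g1 g2]; split.
  under eq_fun do rewrite raddfD /=; exact: measurable_funD.
under eq_fun do rewrite raddfD /=; exact: measurable_funD.
Qed.

Lemma cmeasurableM f g : cmeasurable f -> cmeasurable g ->
  cmeasurable (fun x => f x * g x).
Proof.
have ReM (a b : R[i]) : complex.Re (a * b) = complex.Re a * complex.Re b -
  complex.Im a * complex.Im b by case: a; case: b.
have ImM (a b : R[i]) : complex.Im (a * b) = complex.Re a * complex.Im b +
  complex.Im a * complex.Re b by case: a; case: b.
move=> [f1 f2] [g1 g2]; split.
  under eq_fun do rewrite ReM.
  by apply: measurable_funB; exact: measurable_funM.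
under eq_fun do rewrite ImM.
by apply: measurable_funD; exact: measurable_funM.
Qed.

Lemma cmeasurable_cst c : cmeasurable (fun=> c : R[i]).
Proof. by split; exact: measurable_cst. Qed.

Lemma cmeasurable_real m : measurable_fun setT m ->
  cmeasurable (fun x => (m x)%:C).
Proof. by move=> mm; split => //=; exact: measurable_cst. Qed.

Lemma cmeasurable_expi m : measurable_fun setT m ->
  cmeasurable (fun x => expi (m x)).
Proof.
move=> mm; split => /=; apply: measurableT_comp => //.
  by apply: continuous_measurable_fun; exact: continuous_cos.
by apply: continuous_measurable_fun; exact: continuous_sin.
Qed.

Lemma cmeasurable_cexp f : cmeasurable f -> cmeasurable (fun x => cexp (f x)).
Proof.
move=> [f1 f2]; apply: cmeasurableM; last exact: cmeasurable_expi.
by apply: cmeasurable_real; apply: measurableT_comp.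
Qed.

Lemma cintegrable_dominated f m : cmeasurable f ->
  mu.-integrable setT (EFin \o m) -> (forall x, normc (f x) <= m x) ->
  cintegrable f.
Proof.
move=> [f1 f2] im fm; split.
  apply: (le_integrable _ _ _ im) => //; first exact/measurable_EFinP.
  move=> x _ /=; rewrite lee_fin; apply: le_trans (ler_norm _).
  by apply: le_trans (fm x); exact: Re_normc.
apply: (le_integrable _ _ _ im) => //; first exact/measurable_EFinP.
move=> x _ /=; rewrite lee_fin; apply: le_trans (ler_norm _).
by apply: le_trans (fm x); exact: Im_normc.
Qed.

Lemma cintegrableD f g : cintegrable f -> cintegrable g ->
  cintegrable (fun x => f x + g x).
Proof.
move=> [f1 f2] [g1 g2]; split.
  apply: eq_integrable (integrableD _ f1 g1) => // x _ /=.
  by rewrite raddfD.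
apply: eq_integrable (integrableD _ f2 g2) => // x _ /=.
by rewrite raddfD.
Qed.

Lemma cintegralD f g : cintegrable f -> cintegrable g ->
  cintegral (fun x => f x + g x) = cintegral f + cintegral g.
Proof.
move=> [f1 f2] [g1 g2]; rewrite /cintegral; simpc.
rewrite -!RintegralD//.
by congr (_ +i* _); apply: eq_Rintegral => x _; rewrite raddfD.
Qed.

Lemma cintegrableZ c f : cintegrable f -> cintegrable (fun x => c * f x).
Proof.
case: c => a b [f1 f2]; split.
  apply: eq_integrable (integrableB _ (integrableZl _ a f1) (integrableZl _ b f2)) => //.
  by move=> x _ /=; case: (f x).
apply: eq_integrable (integrableD _ (integrableZl _ a f2) (integrableZl _ b f1)) => //.
by move=> x _ /=; case: (f x).
Qed.

Lemma cintegralZ c f : cintegrable f ->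
  cintegral (fun x => c * f x) = c * cintegral f.
Proof.
case: c => a b [f1 f2]; rewrite /cintegral; simpc.
have e (u : R) h : mu.-integrable setT (EFin \o h) ->
  mu.-integrable setT (EFin \o (fun x => u * h x)).
  by move=> ih; apply: eq_integrable (integrableZl _ u ih).
rewrite -!RintegralZl// -RintegralB ?e// -RintegralD ?e//.
by congr (_ +i* _); apply: eq_Rintegral => x _; case: (f x).
Qed.

Lemma normc_cintegral_le f m : cmeasurable f ->
  mu.-integrable setT (EFin \o m) -> (forall x, normc (f x) <= m x) ->
  normc (cintegral f) <= \int[mu]_(x in setT) m x.
Proof.
move=> mf im fm; have fi := cintegrable_dominated mf im fm.
apply: normc_le_dual => zeta z1; rewrite -cintegralZ//=.
apply: le_Rintegral => //; first by case: (cintegrableZ zeta fi).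
by move=> x _; apply: le_trans (fm x); exact: Re_dual_le.
Qed.

End ComplexIntegral.

(** * The kernel Psi_q *)

Section LaplaceKernel.
Context {R : realType}.
Local Notation mu := (@lebesgue_measure R).
Implicit Types (q y b w : R) (z h : R[i]).

Definition laplace_kernel q z w : R[i] :=
  if 0 < w then (w `^ q)%:C * cexp ('i * w%:C * z) else 0.

Definition power_laplace q z : R[i] := cintegral (laplace_kernel q z).

Lemma Re_iw z w : complex.Re ('i * w%:C * z) = - (w * complex.Im z).
Proof. by case: z => a b; simpc. Qed.

(** All kernels are compared to exponential densities, whose integral is 1: half
    of the exponential decay absorbs the power. *)
Lemma powR_exponential_pdf q b : 0 < q -> 0 < b -> exists2 C, 0 <= C &
  forall w, 0 < w -> w `^ q * expR (- (2 * b * w)) <= C * exponential_pdf b w.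
Proof.
move=> q0 b0; pose C := expR (- q - q * ln (b / q)) / b.
have bq : 0 < b / q by rewrite divr_gt0.
exists C => [|w w0]; first by rewrite divr_ge0 ?expR_ge0 ?ltW.
rewrite (exponential_pdfE _ (ltW w0)) /C mulrA divfK ?gt_eqF//.
rewrite /powR gt_eqF// -!expRD ler_expR.
have := @le_ln1Dx R (w * (b / q) - 1).
have wb : 0 < w * (b / q) by rewrite mulr_gt0.
rewrite ltrBrDl addrN => /(_ wb); rewrite addrC subrK lnM ?posrE// => H.
have : q * ln w <= q * (w * (b / q) - 1 - ln (b / q)).
  by rewrite ler_pM2l//; lra.
have -> : q * (w * (b / q) - 1 - ln (b / q)) = w * b - q - q * ln (b / q).
  by field; rewrite gt_eqF.
lra.
Qed.

Lemma cmeasurable_laplace_kernel q z : cmeasurable (laplace_kernel q z).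
Proof.
have m : cmeasurable (fun w => (w `^ q)%:C * cexp ('i * w%:C * z)).
  apply: cmeasurableM.
    by apply: cmeasurable_real; exact: measurable_powR.
  apply: cmeasurable_cexp; apply: cmeasurableM; last exact: cmeasurable_cst.
  apply: cmeasurableM; first exact: cmeasurable_cst.
  by apply: cmeasurable_real.
have mp : measurable_fun [set: R] (fun w => 0 < w).
  by apply: measurable_fun_ltr => //; exact: measurable_cst.
case: m => m1 m2; split.
  rewrite (_ : (fun _ => _) = fun w => if 0 < w then
    complex.Re ((w `^ q)%:C * cexp ('i * w%:C * z)) else 0).
    by apply: measurable_fun_ifT => //; exact: measurable_cst.
  by apply/funext => w; rewrite /laplace_kernel; case: ifP.
rewrite (_ : (fun _ => _) = fun w => if 0 < w then
  complex.Im ((w `^ q)%:C * cexp ('i * w%:C * z)) else 0).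
  by apply: measurable_fun_ifT => //; exact: measurable_cst.
by apply/funext => w; rewrite /laplace_kernel; case: ifP.
Qed.

Lemma laplace_kernel0 q z w : w <= 0 -> laplace_kernel q z w = 0.
Proof. by rewrite /laplace_kernel ltNge => ->. Qed.

Lemma normc_laplace_kernel q z w : 0 < w ->
  normc (laplace_kernel q z w) = w `^ q * expR (- (w * complex.Im z)).
Proof.
move=> w0; rewrite /laplace_kernel w0 Normc.normcM normc_cexp Re_iw normc_real.
by rewrite ger0_norm// powR_ge0.
Qed.

Lemma laplace_kernel_bound q b : 0 < q -> 0 < b -> exists2 C, 0 <= C &
  forall z w, 2 * b <= complex.Im z ->
    normc (laplace_kernel q z w) <= C * exponential_pdf b w.
Proof.
move=> q0 b0; have [C C0 H] := powR_exponential_pdf q0 b0.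
exists C => // z w bz; have [w0|w0] := ltP 0 w; last first.
  rewrite laplace_kernel0// Normc.normc0 mulr_ge0//.
  by apply: exponential_pdf_ge0; exact: ltW.
rewrite normc_laplace_kernel//; apply: le_trans (H w w0).
by rewrite ler_wpM2l ?powR_ge0// ler_expR lerN2 mulrC ler_pM2l.
Qed.

Lemma integrable_pdfZ C b : 0 < b ->
  mu.-integrable setT (EFin \o (fun w => C * exponential_pdf b w)).
Proof. by move=> b0; apply: (integrableZl _ C (integrable_exponential_pdf b0)). Qed.

Lemma Rintegral_pdfZ C b : 0 < b ->
  \int[mu]_(w in setT) (C * exponential_pdf b w) = C.
Proof.
move=> b0; rewrite RintegralZl//; last exact: integrable_exponential_pdf.
by rewrite /Rintegral integral_exponential_pdf//= mulr1.
Qed.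

Lemma cintegrable_laplace_kernel q z : 0 < q -> 0 < complex.Im z ->
  cintegrable (laplace_kernel q z).
Proof.
move=> q0 z0; pose b := complex.Im z / 2.
have b0 : 0 < b by rewrite divr_gt0.
have [C C0 H] := laplace_kernel_bound q0 b0.
apply: (cintegrable_dominated (cmeasurable_laplace_kernel q z)
  (integrable_pdfZ C b0)) => w.
by apply: H; rewrite /b mulrC divfK.
Qed.

(** First-order counterpart of [jet2], with a prescribed derivative. *)
Definition cder (g : R[i] -> R[i]) (g' : R[i]) z :=
  Oh 2 (fun h => g (z + h) - g z - g' * h).

(** Differentiation under the integral sign; exp(iwh) - 1 - iwh is bounded by
    |wh|^2 exp |wh|, and |h| is kept so small that half of the decay of the
    kernel survives the last factor. *)
Lemma cder_power_laplace q z : 0 < q -> 0 < complex.Im z ->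
  cder (power_laplace q) ('i * power_laplace (q + 1) z) z.
Proof.
move=> q0 z0; pose b := complex.Im z / 4.
have b0 : 0 < b by rewrite divr_gt0.
have q20 : 0 < q + 2 by lra.
have q10 : 0 < q + 1 by lra.
have [C C0 H] := powR_exponential_pdf q20 b0.
exists C, (2 * b); split=> [//||h hb]; first by rewrite mulr_gt0.
have zb : complex.Im z = 4 * b by rewrite /b mulrC divfK.
have zh0 : 0 < complex.Im (z + h).
  have := le_trans (Im_normc h) hb; rewrite raddfD /= ler_norml => /andP[h1 _].
  by lra.
have i1 := cintegrable_laplace_kernel q0 z0.
have i2 := cintegrable_laplace_kernel q0 zh0.
have i3 := cintegrable_laplace_kernel q10 z0.
have -> : power_laplace q (z + h) - power_laplace q z -
    'i * power_laplace (q + 1) z * h =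
    cintegral (fun w => laplace_kernel q (z + h) w + (-1) * laplace_kernel q z w
      + (- ('i * h)) * laplace_kernel (q + 1) z w).
  have j1 := cintegrableZ (-1) i1; have j3 := cintegrableZ (- ('i * h)) i3.
  rewrite (cintegralD (cintegrableD i2 j1) j3) (cintegralD i2 j1) !cintegralZ//.
  by rewrite mulN1r mulNr [in LHS]mulrAC.
rewrite -(Rintegral_pdfZ (C * normc h ^+ 2) b0).
apply: normc_cintegral_le.
- apply: cmeasurableD; first apply: cmeasurableD.
  + exact: cmeasurable_laplace_kernel.
  + by apply: cmeasurableM (cmeasurable_cst _) _; exact: cmeasurable_laplace_kernel.
  + by apply: cmeasurableM (cmeasurable_cst _) _; exact: cmeasurable_laplace_kernel.
- exact: integrable_pdfZ.
move=> w; have [w0|w0] := ltP 0 w; last first.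
  rewrite !laplace_kernel0// !mulr0 !addr0 Normc.normc0.
  rewrite !mulr_ge0 ?exprn_ge0 ?normc_ge0//.
  by apply: exponential_pdf_ge0; exact: ltW.
have -> : laplace_kernel q (z + h) w + (-1) * laplace_kernel q z w
      + (- ('i * h)) * laplace_kernel (q + 1) z w =
  laplace_kernel q z w * (cexp ('i * w%:C * h) - 1 - 'i * w%:C * h).
  rewrite /laplace_kernel w0 powRD ?gt_eqF ?implybT// powRr1 ?ltW//.
  by rewrite mulrDr cexpD rmorphM; ring.
rewrite Normc.normcM normc_laplace_kernel//.
apply: le_trans (ler_wpM2l _ (cexp_taylor1 _)) _.
  by rewrite mulr_ge0 ?powR_ge0 ?expR_ge0.
have nh : normc ('i * w%:C * h) = w * normc h.
  rewrite !Normc.normcM normc_real (gtr0_norm w0) /= expr0n expr1n add0r.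
  by rewrite sqrtr1 mul1r.
rewrite nh exprMn.
have -> : C * normc h ^+ 2 * exponential_pdf b w =
  normc h ^+ 2 * (C * exponential_pdf b w) by ring.
have -> : w `^ q * expR (- (w * complex.Im z)) *
    (w ^+ 2 * normc h ^+ 2 * expR (w * normc h)) =
  normc h ^+ 2 * (w `^ (q + 2) * expR (w * normc h - w * complex.Im z)).
  rewrite powRD ?gt_eqF ?implybT// -[2]/(2%:R) powR_mulrn ?ltW// expRD; ring.
apply: ler_wpM2l; first by rewrite exprn_ge0// normc_ge0.
apply: le_trans (H w w0); rewrite ler_wpM2l ?powR_ge0// ler_expR.
rewrite zb; have := ler_wpM2l (ltW w0) hb; lra.
Qed.

End LaplaceKernel.

Section IntegrationByParts.
Context {R : realType}.
Local Notation mu := (@lebesgue_measure R).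

Lemma expR_decay_cvg0 (b : R) : 0 < b -> expR (- b * x) @[x --> +oo] --> (0 : R).
Proof.
move=> b0; rewrite (_ : (fun x => expR (- b * x)) =
  (fun z => expR (- z)) \o (fun z => b * z)); last first.
  by apply/funext => x /=; rewrite mulNr.
apply: (@cvg_comp _ _ _ _ _ _ (pinfty_nbhs R)); last exact: cvgr_expR.
exact: gt0_cvgMry.
Qed.

Lemma der_expR_linear (b x : R) :
  is_derive x 1 (fun x => expR (b * x)) (b * expR (b * x)).
Proof.
apply: is_derive_eq (der_comp (is_derive_expR _) (derMl b (der_id x))) _.
by rewrite mulr1 mulrC.
Qed.

(** The fundamental theorem of calculus extends to a half line by monotone
    convergence when the integrand is nonnegative; adding a large multiple of
    exp(- b w) makes f nonnegative, and its integral is subtracted afterwards. *)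
Lemma half_line_integral_derivative (f F : R -> R) (C b : R) : 0 < b -> 0 <= C ->
  (forall w : R, 0 < w -> is_derive w 1 F (f w)) ->
  (forall w : R, 0 < w -> {for w, continuous f}) ->
  f w @[w --> 0^'+] --> f 0 -> F w @[w --> 0^'+] --> F 0 ->
  (forall w : R, 0 < w -> `|F w| <= C * expR (- b * w)) ->
  (forall w : R, 0 <= w -> `|f w| <= C * expR (- b * w)) ->
  \int[mu]_(w in `[0, +oo[) f w = - F 0.
Proof.
move=> b0 C0 dF cf f0 F0 FC fC.
pose e (w : R) : R := C * expR (- b * w).
pose E (w : R) : R := - (C / b) * expR (- b * w).
have de (w : R) : is_derive w 1 E (e w).
  apply: is_derive_eq (derMl _ (der_expR_linear _ _)) _.
  by rewrite /e; field; rewrite gt_eqF.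
have ce : continuous e.
  by move=> w; apply: der_continuous (derMl _ (der_expR_linear _ _)).
have cE : continuous E by move=> w; apply: der_continuous (de w).
have ey : E w @[w --> +oo] --> 0.
  rewrite -(mulr0 (- (C / b))); apply: cvgM; first exact: cvg_cst.
  exact: expR_decay_cvg0.
have e0 (w : R) : 0 <= e w by rewrite mulr_ge0 ?expR_ge0.
have Ie : \int[mu]_(w in `[0, +oo[) e w = C / b.
  rewrite (@Rintegral_ge0_continuous_FTC2y _ e E 0 0).
  - by rewrite /E mulr0 expR0 mulr1 sub0r opprK.
  - by [].
  - exact: continuous_subspaceT.
  - exact: ey.
  - by move=> w _; case: (de w).
  - by apply: cvg_at_right_filter; exact: cE.
  - by move=> w _; rewrite derive1E; case: (de w).
have Ife : \int[mu]_(w in `[0, +oo[) (f w + e w) = C / b - F 0.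
  rewrite (@Rintegral_ge0_continuous_FTC2y _ (fun w => f w + e w)
    (fun w => F w + E w) 0 0).
  - by rewrite /E mulr0 expR0 mulr1; ring.
  - by move=> w w0; have := fC w w0; rewrite ler_norml /e => /andP[]; lra.
  - apply/continuous_within_itvcyP; split.
      by move=> w; rewrite in_itv /= andbT => w0; apply: cvgD; [exact: cf|exact: ce].
    by apply: cvgD => //; apply: cvg_at_right_filter; exact: ce.
  - rewrite -(addr0 0); apply: cvgD => //.
    have e_y : C * expR (- b * w) @[w --> +oo] --> (0 : R).
      by rewrite -(mulr0 C); apply: cvgM; [exact: cvg_cst|exact: expR_decay_cvg0].
    apply: (@squeeze_cvgr _ _ _ _ (fun w => - (C * expR (- b * w)))
      (fun w => C * expR (- b * w))) => //; last first.
      by rewrite -oppr0; exact: cvgN.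
    near=> w; rewrite -ler_norml; apply: FC.
    by near: w; exact: nbhs_pinfty_gt.
  - move=> w w0; have D1 := dF w w0; have D2 := de w.
    by case: (derD D1 D2).
  - by apply: cvgD => //; apply: cvg_at_right_filter; exact: cE.
  - move=> w; rewrite in_itv /= andbT => w0; rewrite derive1E.
    have D1 := dF w w0; have D2 := de w.
    by case: (derD D1 D2).
have mD : measurable (`[0, +oo[%classic : set R) by exact: measurable_itv.
have ie : mu.-integrable `[0, +oo[ (EFin \o e).
  have ip : mu.-integrable `[0, +oo[
      (EFin \o (fun w => C / b * exponential_pdf b w)).
    by apply: integrableS (integrable_pdfZ (C / b) b0).
  apply: eq_integrable ip => // w; rewrite inE /= in_itv /= andbT => w0.
  by rewrite exponential_pdfE// mulrA divfK ?gt_eqF.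
have mf : measurable_fun (`[0, +oo[%classic : set R) f.
  apply: subspace_continuous_measurable_fun => //.
  apply/continuous_within_itvcyP; split => // w.
  by rewrite in_itv /= andbT => w0; exact: cf.
have if_ : mu.-integrable `[0, +oo[ (EFin \o f).
  apply: (le_integrable _ _ _ ie) => //; first exact/measurable_EFinP.
  move=> w /=; rewrite in_itv /= andbT => w0.
  by rewrite lee_fin (ger0_norm (e0 w)); exact: fC.
by move: Ife; rewrite RintegralD// Ie => /(canRL (addrK _)) ->; ring.
Unshelve. all: by end_near. Qed.

End IntegrationByParts.

Section PowerLaplaceRecurrence.
Context {R : realType}.
Local Notation mu := (@lebesgue_measure R).

(** Integration by parts: the derivative of w^(q + 1) exp(i w z) has integral 0. *)
Lemma power_laplace_recurrence (q : R) (z : R[i]) : 0 < q -> 0 < complex.Im z ->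
  'i * z * power_laplace (q + 1) z = - ((q + 1)%:C * power_laplace q z).
Proof.
move=> q0 z0; have q10 : 0 < q + 1 by lra.
have i1 := cintegrable_laplace_kernel q0 z0.
have i2 := cintegrable_laplace_kernel q10 z0.
pose X w := (q + 1)%:C * laplace_kernel q z w + 'i * z * laplace_kernel (q + 1) z w.
suff X0 : cintegral X = 0.
  apply/eqP; rewrite -addr_eq0 addrC; apply/eqP; rewrite -X0.
  by rewrite cintegralD ?cintegralZ//; exact: cintegrableZ.
have iX : cintegrable X by apply: cintegrableD; exact: cintegrableZ.
apply/eqP; rewrite -normc_eq0 eq_le normc_ge0 andbT.
apply: normc_le_dual => zeta z1; rewrite -cintegralZ//=.
pose b := complex.Im z / 2; have b0 : 0 < b by rewrite divr_gt0.
have zb : complex.Im z = 2 * b by rewrite /b mulrC divfK.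
have [C1 C10 H1] := powR_exponential_pdf q0 b0.
have [C2 C20 H2] := powR_exponential_pdf q10 b0.
pose c (u : R[i]) (w : R) := complex.Re (u * cexp (w%:C * ('i * z))).
have cB (u : R[i]) (w : R) : `|c u w| <= normc u * expR (- (2 * b * w)).
  apply: le_trans (Re_normc _) _; rewrite Normc.normcM normc_cexp.
  by rewrite (_ : _%:C * _ = 'i * w%:C * z) ?Re_iw ?zb 1?(mulrC w)//; ring.
have dc (u : R[i]) (w : R) : is_derive w 1 (c u) (c (u * ('i * z)) w).
  exact: der_Re_cexp.
pose f (w : R) := (q + 1) * (w `^ q * c zeta w) +
  w `^ (q + 1) * c (zeta * ('i * z)) w.
pose F (w : R) := w `^ (q + 1) * c zeta w.
have dpow (a w : R) : 0 < w -> is_derive w 1 (fun w => w `^ a) (a * w `^ (a - 1)).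
  by move=> w0; exact: is_derive1_powR.
have bnd (a C : R) (u : R[i]) (w : R) : 0 < a -> (forall w : R, 0 < w ->
    w `^ a * expR (- (2 * b * w)) <= C * exponential_pdf b w) -> 0 <= C ->
    0 <= w -> `|w `^ a * c u w| <= normc u * C * b * expR (- b * w).
  move=> a0 H C0; rewrite le_eqVlt => /predU1P[<-|w0].
    rewrite powR0 ?gt_eqF// mul0r normr0.
    apply: mulr_ge0 (expR_ge0 _); apply: mulr_ge0 (ltW b0).
    exact: mulr_ge0 (normc_ge0 _) C0.
  rewrite normrM (ger0_norm (powR_ge0 _ _)).
  apply: le_trans (ler_wpM2l (powR_ge0 _ _) (cB u w)) _.
  have -> : normc u * C * b * expR (- b * w) =
    normc u * (C * (b * expR (- b * w))) by ring.
  rewrite mulrCA ler_wpM2l ?normc_ge0//.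
  by apply: le_trans (H w w0) _; rewrite exponential_pdfE ?(ltW w0).
pose n2 := normc (zeta * ('i * z)).
pose C := normc zeta * C2 * b + (q + 1) * (normc zeta * C1 * b) + n2 * C2 * b.
have p1 : 0 <= normc zeta * C2 * b.
  exact: mulr_ge0 (mulr_ge0 (normc_ge0 _) C20) (ltW b0).
have p2 : 0 <= (q + 1) * (normc zeta * C1 * b).
  exact: mulr_ge0 (ltW q10) (mulr_ge0 (mulr_ge0 (normc_ge0 _) C10) (ltW b0)).
have p3 : 0 <= n2 * C2 * b.
  exact: mulr_ge0 (mulr_ge0 (normc_ge0 _) C20) (ltW b0).
have C0 : 0 <= C by rewrite !addr_ge0.
have cvg0 (a : R) (u : R[i]) : 0 < a -> w `^ a * c u w @[w --> 0^'+] --> 0.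
  move=> a0.
  have cu : c u w @[w --> 0^'+] --> c u 0.
    by apply: cvg_at_right_filter; apply: der_continuous (dc u 0).
  by have H := cvgM (powR_cvg0 a0) cu; rewrite mul0r in H; exact: H.
have f00 : f 0 = 0 by rewrite /f !powR0 ?gt_eqF// !mul0r mulr0 addr0.
have F00 : F 0 = 0 by rewrite /F powR0 ?gt_eqF// mul0r.
suff -> : \int[mu]_(x in setT) complex.Re (zeta * X x) =
    \int[mu]_(x in `[0, +oo[) f x.
  have -> : \int[mu]_(x in `[0, +oo[) f x = - F 0; last by rewrite F00 oppr0.
  apply: (@half_line_integral_derivative _ f F C b) => //.
  - move=> w w0; apply: is_derive_eq (derM (dpow (q + 1) w w0) (dc zeta w)) _.
    by rewrite /f addrK mulrA.
  - move=> w w0; apply: der_continuous.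
    exact: (derD (derMl _ (derM (dpow q w w0) (dc zeta w)))
      (derM (dpow (q + 1) w w0) (dc (zeta * ('i * z)) w))).
  - have cq : (q + 1) * (w `^ q * c zeta w) @[w --> 0^'+] --> (q + 1) * 0.
      by apply: cvgM; [exact: cvg_cst|exact: cvg0].
    have H := cvgD cq (cvg0 _ (zeta * ('i * z)) q10).
    by rewrite f00; rewrite mulr0 addr0 in H; exact: H.
  - by rewrite F00; exact: cvg0.
  - move=> w w0; apply: le_trans (bnd _ _ zeta w q10 H2 C20 (ltW w0)) _.
    by rewrite ler_wpM2r ?expR_ge0// /C -addrA lerDl addr_ge0.
  - move=> w w0; apply: le_trans (ler_normD _ _) _.
    rewrite normrM (gtr0_norm q10).
    have B1 := bnd _ _ zeta w q0 H1 C10 w0.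
    have B2 := bnd _ _ (zeta * ('i * z)) w q10 H2 C20 w0.
    apply: le_trans (lerD (ler_wpM2l (ltW q10) B1) B2) _.
    rewrite mulrA -mulrDl ler_wpM2r ?expR_ge0// /C -addrA.
    by rewrite lerDr.
rewrite [RHS]Rintegral_mkcond; apply: eq_Rintegral => w _.
rewrite patchE mem_setE in_itv /= andbT.
have [w0|w0|<-] := ltgtP 0 w.
- rewrite /X /laplace_kernel w0 /f /c.
  have -> : 'i * w%:C * z = w%:C * ('i * z) by ring.
  move: (cexp _) => E.
  by case: zeta {z1 F n2 p1 p2 p3 C C0 f F00 f00} => s t; case: E => s' t';
    case: z {z0 i1 i2 X iX b b0 zb H1 H2 c cB dc bnd cvg0} => x y; simpc => /=; ring.
- by rewrite /X !laplace_kernel0 ?ltW// !mulr0 addr0 mulr0.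
- by rewrite f00 /X !laplace_kernel0// !mulr0 addr0 mulr0.
Qed.

End PowerLaplaceRecurrence.

Section DecayOfPowerLaplace.
Context {R : realType}.
Implicit Types (q t : R) (z h zeta : R[i]).

Lemma quadratic_is_derive (f : R -> R) (t l C r : R) : 0 <= C -> 0 < r ->
  (forall s, `|s| <= r -> `|f (t + s) - f t - l * s| <= C * `|s| ^+ 2) ->
  is_derive t 1 f l.
Proof.
move=> C0 r0 H.
suff cv : s^-1 *: ((f \o shift t) (s *: 1) - f t) @[s --> 0^'] --> l.
  by split; [apply/cvg_ex; exists l|exact: cvg_lim].
apply/cvgrPdist_le => e e0; near=> s.
have s0 : s != 0 by near: s; exact: nbhs_dnbhs_neq.
have sr : `|s| <= r by near: s; apply: dnbhs0_le.
have se : `|s| <= e / (C + 1).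
  by near: s; apply: dnbhs0_le; rewrite divr_gt0//; lra.
rewrite /= /GRing.scale /= mulr1 (addrC s t).
have -> : l - s^-1 * (f (t + s) - f t) = - (s^-1 * (f (t + s) - f t - l * s)).
  by field.
rewrite normrN normrM normfV ler_pdivrMl ?normr_gt0//.
apply: le_trans (H s sr) _.
rewrite expr2 mulrCA ler_wpM2l//.
move: se; rewrite ler_pdivlMr; last by lra.
have := normr_ge0 s; nra.
Unshelve. all: by end_near. Qed.

Lemma cder_line (g : R[i] -> R[i]) g' z h zeta t : cder g g' (z + t%:C * h) ->
  is_derive t 1 (fun t => complex.Re (zeta * g (z + t%:C * h)))
    (complex.Re (zeta * g' * h)).
Proof.
move=> [C [r [C0 r0 H]]].
apply: (@quadratic_is_derive _ _ _ (normc zeta * C * normc h ^+ 2)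
  (r / (normc h + 1))).
- by rewrite !mulr_ge0 ?exprn_ge0 ?normc_ge0.
- by rewrite divr_gt0//; have := normc_ge0 h; lra.
move=> s sr.
have n : normc (s%:C * h) = `|s| * normc h by rewrite Normc.normcM normc_real.
have hs : normc (s%:C * h) <= r.
  rewrite n; move: sr; rewrite ler_pdivlMr; last by have := normc_ge0 h; lra.
  by have := normr_ge0 s; nra.
have -> : complex.Re (zeta * g (z + (t + s)%:C * h)) -
   complex.Re (zeta * g (z + t%:C * h)) - complex.Re (zeta * g' * h) * s =
   complex.Re (zeta * (g (z + t%:C * h + s%:C * h) - g (z + t%:C * h)
     - g' * (s%:C * h))).
  have -> : z + t%:C * h + s%:C * h = z + (t + s)%:C * h.
    by rewrite rmorphD; ring.
  have -> : complex.Re (zeta * g' * h) * s = complex.Re (zeta * (g' * (s%:C * h))).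
    rewrite (_ : zeta * (g' * (s%:C * h)) = s%:C * (zeta * g' * h)); last by ring.
    by case: (zeta * g' * h) => a b; simpc; rewrite /= mulrC.
  by rewrite !mulrBr !raddfB.
apply: le_trans (Re_normc _) _; rewrite Normc.normcM.
apply: le_trans (ler_wpM2l (normc_ge0 _) (H _ hs)) _.
by rewrite n exprMn [leLHS](_ : _ = normc zeta * C * normc h ^+ 2 * `|s| ^+ 2)//; ring.
Qed.

Let segment_upper z h t : 0 < complex.Im z -> 0 < complex.Im (z + h) ->
  0 <= t <= 1 -> 0 < complex.Im (z + t%:C * h).
Proof.
case: z => a b; case: h => a' b' /= => b0 b1 /andP[t0 t1].
rewrite mul0r addr0; have [b'0|b'0] := leP 0 b'.
  by apply: ltr_wpDr => //; exact: mulr_ge0.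
apply: lt_le_trans b1 _; rewrite lerD2l -subr_ge0.
rewrite (_ : _ - _ = (1 - t) * - b'); last by ring.
by rewrite mulr_ge0//; lra.
Qed.

(** Psi_q(z) is a constant multiple of z^(- q - 1).  The derivative i Psi_(q+1)
    and the recurrence give the equation z Psi_q' = - (q + 1) Psi_q, which makes
    the derivative of |Psi_q(z)|^2 |z|^(2q + 2) vanish along every segment;
    squared moduli avoid complex powers. *)
Lemma normc_power_laplace_cst q z h :
  0 < q -> 0 < complex.Im z -> 0 < complex.Im (z + h) ->
  normc (power_laplace q (z + h)) ^+ 2 * (normc (z + h) ^+ 2) `^ (q + 1) =
  normc (power_laplace q z) ^+ 2 * (normc z ^+ 2) `^ (q + 1).
Proof.
move=> q0 z0 zh0.
pose g t := power_laplace q (z + t%:C * h).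
pose a t := complex.Re (1 * g t); pose b t := complex.Re (- 'i * g t).
pose u t := complex.Re z + t * complex.Re h.
pose v t := complex.Im z + t * complex.Im h.
pose N t := a t * a t + b t * b t; pose S t := u t * u t + v t * v t.
pose D t := N t * S t `^ (q + 1).
have nE t : N t = normc (g t) ^+ 2.
  rewrite /N /a /b; case: (g t) => x y; rewrite normcE2; simpc => /=.
  by ring.
have sE t : S t = normc (z + t%:C * h) ^+ 2.
  rewrite /S /u /v; case: z {z0 zh0 g a b u v N S D nE} => x y.
  by case: h => x' y'; rewrite normcE2; simpc => /=; ring.
have key t : 0 <= t <= 1 -> is_derive t 1 D 0.
  move=> t01; have Zt := segment_upper z0 zh0 t01.
  have rec := power_laplace_recurrence q0 Zt.
  have cd := cder_power_laplace q0 Zt.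
  have da := cder_line 1 cd; have db := cder_line (- 'i) cd.
  have du : is_derive t 1 u (complex.Re h).
    apply: is_derive_eq (derD (der_cst _ _) (derM (der_id t) (der_cst _ _))) _.
    by rewrite mul1r mulr0 addr0 add0r.
  have dv : is_derive t 1 v (complex.Im h).
    apply: is_derive_eq (derD (der_cst _ _) (derM (der_id t) (der_cst _ _))) _.
    by rewrite mul1r mulr0 addr0 add0r.
  have S0 : 0 < S t.
    have : 0 < v t by move: Zt; rewrite /v; case: (z) (h) => [? ?] [? ?]; simpc.
    by rewrite /S => v0; have := sqr_ge0 (u t); have := mulr_gt0 v0 v0; nra.
  have dS := derD (derM du du) (derM dv dv).
  have dP := der_comp (@is_derive1_powR R (q + 1) _ S0) dS.
  have dN := derD (derM da da) (derM db db).
  apply: is_derive_eq (derM dN dP) _.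
  rewrite -/(g t) -/(a t) -/(b t) -/(N t) addrK.
  have -> : S t `^ (q + 1) = S t `^ q * S t.
    by rewrite powRD ?(powRr1 (ltW S0))// (gt_eqF S0) implybT.
  have gE : g t = a t +i* b t.
    by rewrite /a /b; case: (g t) => x y; simpc => /=; congr (_ +i* _); ring.
  set Z := z + t%:C * h in Zt rec cd *.
  set G1 := power_laplace (q + 1) Z in rec cd da db *.
  have ZE : Z = u t +i* v t.
    by rewrite /Z /u /v; case: (z) (h) => [? ?] [? ?]; simpc.
  rewrite -[power_laplace q Z]/(g t) gE ZE in rec.
  clearbody G1; move: rec; rewrite /N /S; move: (a t) (b t) (u t) (v t) => a' b' u' v'.
  case: G1 da db cd => p w _ _ _ rec.
  have e1 : (q + 1) * a' - (u' * w + v' * p) = 0.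
    by have := congr1 (@complex.Re R) rec; simpc => /=; lra.
  have e2 : (q + 1) * b' - (v' * w - u' * p) = 0.
    by have := congr1 (@complex.Im R) rec; simpc => /=; lra.
  move: (h) => [hr hi]; simpc => /=; move: (_ `^ q) => Sq.
  (* The derivative is a combination of the real and imaginary parts e1, e2 of
     the recurrence. *)
  transitivity (2 * Sq * ((a' * ((q + 1) * a' - (u' * w + v' * p)) +
      b' * ((q + 1) * b' - (v' * w - u' * p))) * (u' * hr + v' * hi) +
    (v' * hr - u' * hi) * (a' * ((q + 1) * b' - (v' * w - u' * p)) -
      b' * ((q + 1) * a' - (u' * w + v' * p))))); first by ring.
  by rewrite e1 e2; ring.
have Dc : `|D 1 - D 0| <= 0.
  apply: (@der_bound _ (fun t => D t - D 0) (fun=> 0) 0).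
  - by move=> t /key dk; apply: is_derive_eq (derB dk (der_cst _ _)) _; rewrite subr0.
  - by move=> t _; rewrite normr0.
  - by rewrite subrr.
  - by rewrite ler01 lexx.
move: Dc; rewrite normr_le0 subr_eq0 => /eqP; rewrite /D !nE !sE /g.
by rewrite !rmorph0 !rmorph1 !mul1r !mul0r !addr0.
Qed.

(** The square-integrable profile that dominates Psi_q on horizontal lines. *)
Definition dec (x : R) : R := (Num.sqrt (1 + x ^+ 2))^-1.

Lemma dec_gt0 x : 0 < dec x.
Proof. by rewrite invr_gt0 sqrtr_gt0; have := sqr_ge0 x; lra. Qed.

Lemma dec2 x : dec x ^+ 2 = (1 + x ^+ 2)^-1.
Proof. by rewrite exprVn sqr_sqrtr//; have := sqr_ge0 x; lra. Qed.

Lemma dec_le (x s : R) : `|s| <= 1 -> dec (x + s) <= 2 * dec x.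
Proof.
move=> s1; have := dec_gt0 x; have := dec_gt0 (x + s) => p1 p2.
suff : dec (x + s) ^+ 2 <= (2 * dec x) ^+ 2.
  by rewrite ler_pXn2r// nnegrE ?mulr_ge0// ltW.
have d1 := dec2 x; have d2 := dec2 (x + s).
suff : (1 + (x + s) ^+ 2)^-1 <= 4 * (1 + x ^+ 2)^-1 by rewrite -d1 -d2; lra.
have h1 : 0 < 1 + (x + s) ^+ 2 by have := sqr_ge0 (x + s); lra.
have h2 : 0 < 1 + x ^+ 2 by have := sqr_ge0 x; lra.
rewrite -ler_pdivrMr ?invr_gt0// invrK mulrC ler_pdivrMr//.
have : s ^+ 2 <= 1 by rewrite -real_normK ?num_real// expr_le1.
by have := sqr_ge0 (2 * x + 2 * s); have := sqr_ge0 (x + 2 * s); nra.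
Qed.

Lemma power_laplace_decay q y0 : 0 < q -> 0 < y0 -> exists2 C, 0 <= C &
  forall z, y0 <= complex.Im z ->
    normc (power_laplace q z) <= C * dec (complex.Re z).
Proof.
move=> q0 y00.
pose z1 : R[i] := 0 +i* y0.
pose K := normc (power_laplace q z1) ^+ 2 * (normc z1 ^+ 2) `^ (q + 1).
have K0 : 0 <= K by rewrite mulr_ge0 ?powR_ge0 ?sqr_ge0.
pose m := Num.min 1 (y0 ^+ 2).
have m0 : 0 < m by rewrite lt_min ltr01 exprn_gt0.
have y2 : 0 < y0 ^+ 2 by rewrite exprn_gt0.
pose C2 := K / ((y0 ^+ 2) `^ q * m).
have C20 : 0 <= C2 by rewrite divr_ge0// mulr_ge0 ?powR_ge0// ltW.
exists (Num.sqrt C2); first exact: sqrtr_ge0.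
move=> z yz; have z0 : 0 < complex.Im z by exact: lt_le_trans yz.
have E : normc (power_laplace q z) ^+ 2 * (normc z ^+ 2) `^ (q + 1) = K.
  have := @normc_power_laplace_cst q z1 (z - z1) q0 y00.
  by rewrite addrC subrK => /(_ z0).
have nz : normc z ^+ 2 = complex.Re z ^+ 2 + complex.Im z ^+ 2.
  by case: (z) => x y; rewrite normcE2.
have yz2 : y0 ^+ 2 <= complex.Im z ^+ 2.
  by rewrite ler_pXn2r// nnegrE ltW.
have nz0 : y0 ^+ 2 <= normc z ^+ 2 by rewrite nz; have := sqr_ge0 (complex.Re z); lra.
have nzm : m * (1 + complex.Re z ^+ 2) <= normc z ^+ 2.
  have [m1 m2] : m <= 1 /\ m <= y0 ^+ 2 by rewrite /m !ge_min !lexx orbT.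
  by rewrite nz; have := sqr_ge0 (complex.Re z); nra.
have d0 := dec_gt0 (complex.Re z).
suff : normc (power_laplace q z) ^+ 2 <= (Num.sqrt C2 * dec (complex.Re z)) ^+ 2.
  rewrite ler_pXn2r// nnegrE ?normc_ge0//.
  exact: mulr_ge0 (sqrtr_ge0 _) (ltW d0).
rewrite exprMn (sqr_sqrtr C20).
suff : normc (power_laplace q z) ^+ 2 <= C2 * (1 + complex.Re z ^+ 2)^-1.
  have := congr1 (fun v => C2 * v) (dec2 (complex.Re z)) => /= d2. lra.
rewrite ler_pdivlMr; last first.
  by have := sqr_ge0 (complex.Re z); lra.
rewrite /C2 ler_pdivlMr; last by rewrite mulr_gt0// powR_gt0.
rewrite -E -mulrA ler_wpM2l ?sqr_ge0// powRD; last first.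
  by rewrite (gt_eqF (lt_le_trans y2 nz0)) implybT.
rewrite powRr1 ?sqr_ge0// mulrCA ler_pM ?powR_ge0//.
- by rewrite mulr_ge0// ?(ltW m0)//; have := sqr_ge0 (complex.Re z); lra.
- by apply: ge0_ler_powR; rewrite ?nnegrE ?(ltW q0) ?(ltW y2) ?sqr_ge0.
- by rewrite mulrC.
Qed.

End DecayOfPowerLaplace.

(** * The holomorphic extension of the wavelet transforms *)

Section HolomorphicExtension.
Context {R : realType}.
Local Notation mu := (@lebesgue_measure R).

(** The third-order remainder inherits the decay of the third derivative, which is
    what allows the expansion to be integrated against a function of L^2. *)
Lemma power_laplace_taylor (p y0 : R) : 0 < p -> 0 < y0 -> exists2 C, 0 <= C &
  forall z h : R[i], 2 * y0 <= complex.Im z -> normc h <= Num.min 1 y0 ->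
    normc (power_laplace p (z + h) - power_laplace p z -
      'i * power_laplace (p + 1) z * h -
      (- 2^-1) * power_laplace (p + 1 + 1) z * h ^+ 2)
    <= C * dec (complex.Re z) * normc h ^+ 3.
Proof.
move=> p0 y00.
have p1 : 0 < p + 1 by lra.
have p2 : 0 < p + 1 + 1 by lra.
have p3 : 0 < p + 1 + 1 + 1 by lra.
have [C C0 H] := power_laplace_decay p3 y00.
exists (C * 2) => [|z h zy]; first by rewrite mulr_ge0.
rewrite le_min => /andP[h1 hy].
have Zt (t : R) : 0 <= t <= 1 -> y0 <= complex.Im (z + t%:C * h) /\
    dec (complex.Re (z + t%:C * h)) <= 2 * dec (complex.Re z).
  move=> /andP[t0 t1]; have n1 := Im_normc h; have n2 := Re_normc h.
  case: (z) zy => a b /= zy; case: (h) h1 hy n1 n2 => a' b' h1 hy n1 n2.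
  simpc => /=; split.
    have : `|t * b'| <= y0.
      rewrite normrM (ger0_norm t0); apply: le_trans (le_trans n1 hy).
      by rewrite ler_piMl.
    by rewrite ler_norml => /andP[]; lra.
  apply: dec_le; rewrite normrM (ger0_norm t0); apply: le_trans (le_trans n2 h1).
  by rewrite ler_piMl.
apply: normc_le_dual => zeta z1.
pose r (k : nat) q (t : R) :=
  complex.Re (zeta * ('i * h) ^+ k * power_laplace q (z + t%:C * h)).
have D (k : nat) (q t : R) : 0 < q -> 0 <= t <= 1 ->
    is_derive t 1 (r k q) (r k.+1 (q + 1) t).
  move=> q0 /Zt[ht _]; have zt := lt_le_trans y00 ht.
  apply: is_derive_eq (cder_line _ (cder_power_laplace q0 zt)) _.
  by rewrite /r exprSr; congr complex.Re; ring.
have := @taylor2 _ (r 0%N p) (r 1%N (p + 1)) (r 2%N (p + 1 + 1))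
  (r 3%N (p + 1 + 1 + 1)) (C * 2 * dec (complex.Re z) * normc h ^+ 3)
  (fun t => D 0%N p t p0) (fun t => D 1%N _ t p1) (fun t => D 2%N _ t p2).
have B (t : R) : 0 <= t <= 1 -> `|r 3%N (p + 1 + 1 + 1) t| <=
    C * 2 * dec (complex.Re z) * normc h ^+ 3.
  move=> /Zt[ht dt]; apply: le_trans (Re_normc _) _.
  rewrite (Normc.normcM (zeta * _)) (Normc.normcM zeta) normcX.
  rewrite (Normc.normcM 'i) (_ : normc 'i = 1) ?mul1r; last first.
    by rewrite /= expr0n expr1n add0r sqrtr1.
  rewrite [leRHS]mulrC ler_pM ?mulr_ge0 ?exprn_ge0 ?normc_ge0//.
    by rewrite ler_piMl ?exprn_ge0 ?normc_ge0.
  apply: le_trans (H _ ht) _; rewrite -mulrA; exact: ler_wpM2l.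
move=> /(_ B); apply: le_trans; apply: le_trans (ler_norm _).
rewrite /r mul1r mul0r addr0 expr0 mulr1 expr1.
have -> : complex.Re (zeta * ('i * h) ^+ 2 * power_laplace (p + 1 + 1) z) / 2 =
    complex.Re (zeta * (- 2^-1 * power_laplace (p + 1 + 1) z * h ^+ 2)).
  have -> : zeta * (- 2^-1 * power_laplace (p + 1 + 1) z * h ^+ 2) =
    (2^-1)%:C * (zeta * ('i * h) ^+ 2 * power_laplace (p + 1 + 1) z).
    by rewrite exprMn sqr_i fmorphV rmorph_nat; ring.
  by case: (zeta * _ * _) => a b; simpc; rewrite /= mulrC.
have E : zeta * ('i * power_laplace (p + 1) z * h) =
  zeta * ('i * h) * power_laplace (p + 1) z by ring.
by rewrite !mulrBr E !raddfB.
Qed.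

End HolomorphicExtension.

Section CauchyWeight.
Context {R : realType}.
Local Notation mu := (@lebesgue_measure R).

(** It matters that the value does not depend on x: this is what bounds
    [extension] uniformly on a half plane. *)
Lemma integral_cauchy_weight (x : R) :
  (\int[mu]_t ((oneDsqr (x - t))^-1)%:E = pi%:E)%E.
Proof.
pose G (t : R) : R := (oneDsqr t)^-1.
have cG : continuous G by exact: continuous_oneDsqrV.
have G0 (t : R) : 0 <= G t by rewrite invr_ge0 (le_trans ler01)// oneDsqr_ge1.
have I0 : (\int[mu]_t (G t)%:E = pi%:E)%E.
  rewrite ge0_symfun_integralT//; last first.
    by move=> t; rewrite /G /oneDsqr /= sqrrN.
  rewrite -set_itvcy integral0y_oneDsqr -EFinM; congr EFin.
  by field.
pose F (t : R) : R := t - x.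
have dF (t : R) : is_derive t 1 F 1.
  by apply: is_derive_eq (derB (der_id t) (der_cst _ _)) _; rewrite subr0.
have F'E : derive1 F = cst 1 by apply/funext => t; rewrite derive1E; case: (dF t).
have := @increasing_ge0_integration_by_substitutionT R F G.
rewrite I0 F'E => -> //.
- apply: eq_integral => t _ /=; rewrite /F /oneDsqr mulr1 -sqrrN opprB.
  by [].
- by move=> s t st; rewrite /F ltrD2r.
- by move=> t; exact: cvg_cst.
- exact: is_cvg_cst.
- exact: is_cvg_cst.
- exact: cvg_addrr_Ny.
- exact: cvg_addrr.
Qed.

Lemma integrable_cauchy_weight (x : R) :
  mu.-integrable setT (EFin \o (fun t => (oneDsqr (x - t))^-1)).
Proof.
have c : continuous (fun t : R => (oneDsqr (x - t))^-1).
  move=> t; apply: (@continuous_comp _ _ _ (fun t => x - t) (fun t => (oneDsqr t)^-1)).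
    by apply: der_continuous (derB (der_cst x t) (der_id t)).
  exact: continuous_oneDsqrV.
apply/integrableP; split.
  by apply/measurable_EFinP; exact: continuous_measurable_fun.
have w0 (t : R) : 0 <= (oneDsqr (x - t))^-1.
  by rewrite invr_ge0 (le_trans ler01)// oneDsqr_ge1.
under eq_integral do rewrite /= (ger0_norm (w0 _)).
by rewrite integral_cauchy_weight ltry.
Qed.

End CauchyWeight.

Section ConvolutionExtension.
Context {R : realType}.
Local Notation mu := (@lebesgue_measure R).
Variable f : R -> R[i].
Hypothesis mf : cmeasurable f.
Hypothesis f2 : mu.-integrable setT (EFin \o (fun t => normc (f t) ^+ 2)).
Implicit Types (z h : R[i]) (k : R -> R[i]).

(** In place of the Cauchy-Schwarz inequality, |f k| <= |f|^2 + |k|^2 provides an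
    integrable majorant. *)
Let majorant x (C : R) : R -> R :=
  fun t => normc (f t) ^+ 2 + C ^+ 2 * (oneDsqr (x - t))^-1.

Let integrable_majorant x C : mu.-integrable setT (EFin \o majorant x C).
Proof.
have iw := integrableZl measurableT (C ^+ 2) (integrable_cauchy_weight x).
by apply: eq_integrable (integrableD measurableT f2 iw).
Qed.

Let Rintegral_majorant x C : \int[mu]_(t in setT) majorant x C t =
  \int[mu]_(t in setT) (normc (f t) ^+ 2) + C ^+ 2 * pi.
Proof.
have iw := integrableZl measurableT (C ^+ 2) (integrable_cauchy_weight x).
rewrite RintegralD// RintegralZl//; last exact: integrable_cauchy_weight.
by rewrite [in X in _ + _ * X]/Rintegral integral_cauchy_weight.
Qed.

Let majorantP x C (k : R[i]) t : 0 <= C -> normc k <= C * dec (x - t) ->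
  normc (f t * k) <= majorant x C t.
Proof.
move=> C0 H; rewrite Normc.normcM /majorant.
have -> : C ^+ 2 * (oneDsqr (x - t))^-1 = (C * dec (x - t)) ^+ 2.
  by rewrite [RHS]exprMn dec2.
have := normc_ge0 (f t); have := normc_ge0 k.
move: (normc k) (C * dec (x - t)) (normc (f t)) H => a b c ab a0 c0.
have := sqr_ge0 (c - b); have : c * a <= c * b by rewrite ler_wpM2l.
nra.
Qed.

Definition extension p z : R[i] :=
  cintegral (fun t => f t * power_laplace p (z - t%:C)).

Lemma cmeasurable_power_laplace_line q z : 0 < q -> 0 < complex.Im z ->
  cmeasurable (fun t : R => power_laplace q (z - t%:C)).
Proof.
move=> q0 z0.
have zt (t : R) : 0 < complex.Im (z + t%:C * (-1)).
  by case: (z) z0 => a b; simpc.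
have D (zeta : R[i]) t := cder_line zeta (cder_power_laplace q0 (zt t)).
have E (t : R) : z - t%:C = z + t%:C * (-1) by rewrite mulrN1.
have e (w : R[i]) : complex.Im w = complex.Re (- 'i * w).
  by case: w => a b; simpc.
split.
  rewrite (_ : (fun _ => _) =
    fun t : R => complex.Re (1 * power_laplace q (z + t%:C * (-1)))).
    by apply: continuous_measurable_fun => t; exact: der_continuous (D 1 t).
  by apply/funext => t; rewrite E mul1r.
rewrite (_ : (fun _ => _) =
  fun t : R => complex.Re (- 'i * power_laplace q (z + t%:C * (-1)))).
  by apply: continuous_measurable_fun => t; exact: der_continuous (D (- 'i) t).
by apply/funext => t; rewrite E e.
Qed.

Lemma cintegrable_conv q z : 0 < q -> 0 < complex.Im z ->
  cintegrable (fun t => f t * power_laplace q (z - t%:C)).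
Proof.
move=> q0 z0; have [C C0 H] := power_laplace_decay q0 z0.
apply: cintegrable_dominated (integrable_majorant (complex.Re z) C) _.
  by apply: cmeasurableM => //; exact: cmeasurable_power_laplace_line.
move=> t; apply: majorantP => //.
have -> : complex.Re z - t = complex.Re (z - t%:C) by case: (z).
by apply: H; case: (z) => a b /=; rewrite oppr0 addr0.
Qed.

Lemma extension_bounded p y0 : 0 < p -> 0 < y0 -> exists P, forall z,
  y0 <= complex.Im z -> normc (extension p z) <= P.
Proof.
move=> p0 y00; have [C C0 H] := power_laplace_decay p0 y00.
exists (\int[mu]_(t in setT) (normc (f t) ^+ 2) + C ^+ 2 * pi) => z yz.
rewrite -(Rintegral_majorant (complex.Re z)).
apply: normc_cintegral_le => //.
  apply: cmeasurableM => //; apply: cmeasurable_power_laplace_line => //.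
  exact: lt_le_trans yz.
move=> t; apply: majorantP => //.
have -> : complex.Re z - t = complex.Re (z - t%:C) by case: (z).
by apply: H; case: (z) yz => a b /=; rewrite oppr0 addr0.
Qed.

Lemma jet2_extension p z : 0 < p -> 0 < complex.Im z -> jet2 (extension p) z.
Proof.
move=> p0 z0; pose y0 := complex.Im z / 2.
have y00 : 0 < y0 by rewrite divr_gt0.
have zy : complex.Im z = 2 * y0 by rewrite /y0 mulrC divfK.
have p1 : 0 < p + 1 by lra.
have p2 : 0 < p + 1 + 1 by lra.
have [C C0 H] := power_laplace_taylor p0 y00.
pose k (q : R) t := f t * power_laplace q (z - t%:C).
exists ('i * cintegral (k (p + 1))), (- 2^-1 * cintegral (k (p + 1 + 1))).
pose M := \int[mu]_(t in setT) majorant (complex.Re z) C t.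
exists M, (Num.min 1 y0); split.
- apply: Rintegral_ge0 => t _; apply: addr_ge0; first exact: sqr_ge0.
  apply: mulr_ge0; first exact: sqr_ge0.
  by rewrite invr_ge0 (le_trans ler01)// oneDsqr_ge1.
- by rewrite lt_min ltr01.
move=> h hr.
have zh0 : 0 < complex.Im (z + h).
  have /andP[h1 _] : - y0 <= complex.Im h <= y0.
    by rewrite -ler_norml (le_trans (Im_normc h))// (le_trans hr)// ge_min lexx orbT.
  by rewrite raddfD /= zy; lra.
have i0 := cintegrable_conv p0 z0; have i1 := cintegrable_conv p1 z0.
have i2 := cintegrable_conv p2 z0; have ih := cintegrable_conv p0 zh0.
have j0 := cintegrableZ (-1) i0; have j1 := cintegrableZ (- ('i * h)) i1.
have j2 := cintegrableZ (2^-1 * h ^+ 2) i2.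
have -> : extension p (z + h) - extension p z -
    'i * cintegral (k (p + 1)) * h - - 2^-1 * cintegral (k (p + 1 + 1)) * h ^+ 2 =
  cintegral (fun t => ((f t * power_laplace p (z + h - t%:C) +
    -1 * (f t * power_laplace p (z - t%:C))) + - ('i * h) * k (p + 1) t) +
    (2^-1 * h ^+ 2) * k (p + 1 + 1) t).
  have alg (a b c d : R[i]) : a - b - 'i * c * h - - 2^-1 * d * h ^+ 2 =
    a + -1 * b + - ('i * h) * c + 2^-1 * h ^+ 2 * d by ring.
  apply: etrans (alg _ _ _ _) _; apply/esym.
  apply: etrans (cintegralD (cintegrableD (cintegrableD ih j0) j1) j2) _.
  apply: (congr2 +%R _ (cintegralZ _ i2)).
  apply: etrans (cintegralD (cintegrableD ih j0) j1) _.
  apply: (congr2 +%R _ (cintegralZ _ i1)).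
  apply: etrans (cintegralD ih j0) _.
  exact: (congr2 +%R erefl (cintegralZ _ i0)).
have n3 : 0 <= normc h ^+ 3 by rewrite exprn_ge0// normc_ge0.
have -> : M * normc h ^+ 3 =
    \int[mu]_(t in setT) (normc h ^+ 3 * majorant (complex.Re z) C t).
  by rewrite RintegralZl// mulrC.
apply: normc_cintegral_le.
- have mk q' z' : 0 < q' -> 0 < complex.Im z' ->
    cmeasurable (fun t => f t * power_laplace q' (z' - t%:C)).
    by move=> *; apply: cmeasurableM => //; exact: cmeasurable_power_laplace_line.
  apply: cmeasurableD; first apply: cmeasurableD; first apply: cmeasurableD.
  + exact: mk.
  + by apply: cmeasurableM (cmeasurable_cst _) _; exact: mk.
  + by apply: cmeasurableM (cmeasurable_cst _) _; exact: mk.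
  + by apply: cmeasurableM (cmeasurable_cst _) _; exact: mk.
- exact: (integrableZl measurableT (normc h ^+ 3) (integrable_majorant _ C)).
move=> t; have -> : f t * power_laplace p (z + h - t%:C) +
    -1 * (f t * power_laplace p (z - t%:C)) + - ('i * h) * k (p + 1) t +
    (2^-1 * h ^+ 2) * k (p + 1 + 1) t =
  f t * (power_laplace p (z - t%:C + h) - power_laplace p (z - t%:C) -
      'i * power_laplace (p + 1) (z - t%:C) * h -
      (- 2^-1) * power_laplace (p + 1 + 1) (z - t%:C) * h ^+ 2).
  have alg (v a b c d : R[i]) :
    v * a + -1 * (v * b) + - ('i * h) * (v * c) + (2^-1 * h ^+ 2) * (v * d) =
    v * (a - b - 'i * c * h - - 2^-1 * d * h ^+ 2) by ring.
  by rewrite /k (addrAC z h); exact: alg.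
set T := (X in f t * X).
have zt : 2 * y0 <= complex.Im (z - t%:C).
  by rewrite -zy; case: (z) => a b /=; rewrite oppr0 addr0.
have TB := H (z - t%:C) h zt hr; rewrite -/T in TB.
have [h0|h0] := eqVneq (normc h) 0.
  have T0 : T = 0.
    by apply/eqP; rewrite -normc_eq0 eq_le normc_ge0 andbT (le_trans TB)// h0
      expr0n mulr0.
  by rewrite T0 mulr0 Normc.normc0 h0 expr0n mul0r.
have h3 : 0 < normc h ^+ 3 by rewrite exprn_gt0// lt_neqAle eq_sym h0 normc_ge0.
have hc : ((normc h ^+ 3)%:C : R[i]) != 0 by rewrite fmorph_eq0 gt_eqF.
rewrite -(divfK hc T) mulrA Normc.normcM normc_real gtr0_norm// mulrC.
rewrite ler_pM2l//; apply: majorantP => //.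
rewrite Normc.normcM Normc.normcV normc_real gtr0_norm// ler_pdivrMr//.
have -> : complex.Re z - t = complex.Re (z - t%:C) by case: (z).
exact: TB.
Qed.

End ConvolutionExtension.

Section WaveletTransformAsExtension.
Context {R : realType}.
Local Notation mu := (@lebesgue_measure R).
Implicit Types (f : R -> R[i]) (p x : R) (k : int).

Lemma inL2_integrable_sqr f : inL 2%:E f ->
  cmeasurable f /\ mu.-integrable setT (EFin \o (fun t => normc (f t) ^+ 2)).
Proof.
move=> [mf nf]; split=> //; case: mf => m1 m2.
apply/integrableP; split.
  apply/measurable_EFinP.
  rewrite (_ : (fun _ => _) = fun t => complex.Re (f t) ^+ 2 + complex.Im (f t) ^+ 2).
    by apply: measurable_funD; exact: measurable_funX.
  by apply/funext => t; case: (f t) => a b; rewrite normcE2.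
have := poweR_lty 2 nf; rewrite /cLnorm poweR_Lnorm//.
congr (_ < +oo)%E; apply: eq_integral => t _ /=.
rewrite ger0_norm ?normc_ge0// ger0_norm ?sqr_ge0//.
by rewrite -[2]/(2%:R) powR_mulrn// normc_ge0.
Qed.

Definition wavelet_cst p k : R := (2 * pi)^-1 * (2 ^ k) `^ p.

Lemma exprz2_gt0 k : 0 < (2 : R) ^ k.
Proof. exact: exprz_gt0. Qed.

Lemma wavelet_cst_gt0 p k : 0 < wavelet_cst p k.
Proof.
by rewrite mulr_gt0 ?invr_gt0 ?mulr_gt0 ?pi_gt0 ?powR_gt0 ?exprz2_gt0.
Qed.

Lemma wavelet_cstS p k : wavelet_cst p (k + 1) = 2 `^ p * wavelet_cst p k.
Proof.
rewrite /wavelet_cst expfzDr ?pnatr_eq0// expr1z powRM ?ltW ?exprz2_gt0//.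
by ring.
Qed.

Lemma cauchy_waveletE p k x : 0 < p -> cauchy_wavelet p k x =
  (wavelet_cst p k)%:C * power_laplace p (x +i* 2 ^ k).
Proof.
move=> p0; have k0 := exprz2_gt0 k.
rewrite /cauchy_wavelet /wavelet_cst rmorphM -mulrA; congr (_ * _).
have ic : cintegrable (laplace_kernel p (x +i* 2 ^ k)).
  by apply: cintegrable_laplace_kernel.
rewrite /power_laplace -cintegralZ//; congr cintegral; apply/funext => w.
rewrite /cauchy_hat pmulr_rgt0//; have [w0|w0] := ltP 0 w; last first.
  by rewrite laplace_kernel0// mulr0 mul0r.
rewrite /laplace_kernel w0 powRM ?ltW// /cexp.
have -> : 'i * w%:C * (x +i* 2 ^ k) = (- (2 ^ k * w)) +i* (w * x).
  by simpc; rewrite mulrC.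
by rewrite /= !rmorphM; ring.
Qed.

Lemma wavelet_transformE p k f x : 0 < p -> cmeasurable f ->
  mu.-integrable setT (EFin \o (fun t => normc (f t) ^+ 2)) ->
  wavelet_transform p k f x =
  (wavelet_cst p k)%:C * extension f p (x +i* 2 ^ k).
Proof.
move=> p0 mf f2; have k0 := exprz2_gt0 k.
have ic : cintegrable (fun t => f t * power_laplace p (x +i* 2 ^ k - t%:C)).
  by apply: cintegrable_conv.
rewrite /extension -(cintegralZ _ ic); congr cintegral; apply/funext => t.
rewrite cauchy_waveletE// mulrCA; congr (_ * (_ * power_laplace _ _)).
by simpc.
Qed.

End WaveletTransformAsExtension.

Section LineSuprema.
Context {R : realType}.
Variables (p : R) (f1 f2 : R -> R[i]).
Hypotheses (p0 : 0 < p) (L1 : inL 2%:E f1) (L2 : inL 2%:E f2).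
Local Notation W := (wavelet_transform p).
Local Notation N := (wavelet_sup p f1 f2).
Local Notation F f := (extension f p).
Implicit Types (k : int) (x s : R).

(** The supremum of both extensions on the line Im z = 2^k. *)
Definition line_sup k : R := N k / wavelet_cst p k.

Lemma normc_wavelet_transform f k x : inL 2%:E f ->
  normc (W k f x) = wavelet_cst p k * normc (F f (x +i* 2 ^ k)).
Proof.
move=> /inL2_integrable_sqr[mf f2i]; rewrite wavelet_transformE//.
by rewrite Normc.normcM normc_real gtr0_norm// wavelet_cst_gt0.
Qed.

Let S k := [set r | exists x, r = normc (W k f1 x) \/ r = normc (W k f2 x)].

Lemma wavelet_transform_le_sup k x :
  normc (W k f1 x) <= N k /\ normc (W k f2 x) <= N k.
Proof.
have k0 := exprz2_gt0 (R := R) k; have c0 := wavelet_cst_gt0 p k.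
have [m1 i1] := inL2_integrable_sqr L1; have [m2 i2] := inL2_integrable_sqr L2.
have [P1 H1] := extension_bounded m1 i1 p0 k0.
have [P2 H2] := extension_bounded m2 i2 p0 k0.
have hs : has_sup (S k).
  split; first by exists (normc (W k f1 0)), 0; left.
  exists (wavelet_cst p k * Num.max P1 P2) => r [y [->|->]].
    rewrite normc_wavelet_transform// ler_pM2l// le_max.
    by apply/orP; left; exact: H1.
  rewrite normc_wavelet_transform// ler_pM2l// le_max.
  by apply/orP; right; exact: H2.
by split; apply: sup_upper_bound => //; exists x; [left|right].
Qed.

Lemma extension_le_line_sup k x s : 2 ^ k <= s ->
  normc (F f1 (x +i* s)) <= line_sup k /\ normc (F f2 (x +i* s)) <= line_sup k.
Proof.
have k0 := exprz2_gt0 (R := R) k; have c0 := wavelet_cst_gt0 p k.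
have [m1 i1] := inL2_integrable_sqr L1; have [m2 i2] := inL2_integrable_sqr L2.
have [P1 H1] := extension_bounded m1 i1 p0 k0.
have [P2 H2] := extension_bounded m2 i2 p0 k0.
move=> ks; split.
  apply: (@half_plane_bound _ _ (2 ^ k) P1) => // [y t kt|y].
    by split; [apply: jet2_extension => //; exact: lt_le_trans kt|exact: H1].
  rewrite ler_pdivlMr// mulrC -normc_wavelet_transform//.
  by case: (wavelet_transform_le_sup k y).
apply: (@half_plane_bound _ _ (2 ^ k) P2) => // [y t kt|y].
  by split; [apply: jet2_extension => //; exact: lt_le_trans kt|exact: H2].
rewrite ler_pdivlMr// mulrC -normc_wavelet_transform//.
by case: (wavelet_transform_le_sup k y).
Qed.

Lemma line_sup_le k l : 2 ^ k <= (2 : R) ^ l -> line_sup l <= line_sup k.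
Proof.
move=> kl; rewrite ler_pdivrMr ?wavelet_cst_gt0//.
apply: ge_sup; first by exists (normc (W l f1 0)), 0; left.
move=> r [x]; have [H1 H2] := extension_le_line_sup x kl.
by case=> ->; rewrite normc_wavelet_transform// mulrC ler_pM2r ?wavelet_cst_gt0.
Qed.

End LineSuprema.

(** * The stability theorem *)

Lemma exp_zero_eventually (R : realType) (M0 : R) :
  tends_to0_exponentially (fun M : R => if M0 <= M then 0 else 1).
Proof.
exists 1, 1; split => //; near=> M.
have -> : M0 <= M by near: M; apply: nbhs_pinfty_ge; exact: num_real.
by rewrite normr0 mul1r expR_ge0.
Unshelve. all: by end_near. Qed.

(** The powers of 2^p come from the normalizations of the wavelets: consecutive
    scales differ by the factor 2^p, which enters once through the quotients and
    twice through N_(j-1) / N_(j+1).  The latter ratio, once normalized, is at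
    least 1, and may therefore be raised to the power 4/3. *)
Lemma wavelet_ratio_stability (R : realType) (p eps c L : R) (j : int)
    (f1 f2 : R -> R[i]) :
  let W := wavelet_transform p in
  let N := wavelet_sup p f1 f2 in
  0 < p -> 0 < eps < 1 -> 0 < c -> eps <= c -> inL 2%:E f1 -> inL 2%:E f2 ->
  (forall x : R, - L <= x <= L ->
     [/\ `|normc (W j f1 x) ^+ 2 - normc (W j f2 x) ^+ 2| <= eps * N j ^+ 2,
         `|normc (W (j + 1) f1 x) ^+ 2 - normc (W (j + 1) f2 x) ^+ 2|
           <= eps * N (j + 1) ^+ 2,
         c * N j ^+ 2 <= normc (W j f1 x) ^+ 2 /\
         c * N j ^+ 2 <= normc (W j f2 x) ^+ 2 &
         c * N (j + 1) ^+ 2 <= normc (W (j + 1) f1 x) ^+ 2 /\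
         c * N (j + 1) ^+ 2 <= normc (W (j + 1) f2 x) ^+ 2]) ->
  forall x : R, - (L - 106 * 2 ^ j) <= x <= L - 106 * 2 ^ j ->
    normc (W (j + 2) f1 x / W (j + 1) f1 x - W (j + 2) f2 x / W (j + 1) f2 x)
    <= 3 * 2 `^ p * ((2 `^ p) ^+ 2) `^ (4 / 3) / c *
       (N (j - 1) / N (j + 1)) `^ (4 / 3) * eps `^ (4 / 15).
Proof.
move=> W N p0 e01 c0 ec L1 L2 Hyp x hx.
pose F1 := extension f1 p; pose F2 := extension f2 p.
pose kap := @wavelet_cst R p; pose b := line_sup p f1 f2.
have kap0 k : 0 < kap k by exact: wavelet_cst_gt0.
pose h : R := 2 ^ j; have h0 : 0 < h by exact: exprz2_gt0.
have h1 : (2 : R) ^ (j + 1) = 2 * h.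
  by rewrite expfzDr ?pnatr_eq0// expr1z mulrC.
have h2 : (2 : R) ^ (j + 2) = 4 * h.
  by rewrite expfzDr ?pnatr_eq0// mulrC -exprnP expr2 -natrM.
have hm : (2 : R) ^ (j - 1) = h / 2.
  by rewrite expfzDr ?pnatr_eq0// exprN1.
have WE1 k y : W k f1 y = (kap k)%:C * F1 (y +i* 2 ^ k).
  by case: (inL2_integrable_sqr L1) => ? ?; exact: wavelet_transformE.
have WE2 k y : W k f2 y = (kap k)%:C * F2 (y +i* 2 ^ k).
  by case: (inL2_integrable_sqr L2) => ? ?; exact: wavelet_transformE.
have NE k : N k = kap k * b k.
  by rewrite mulrC /b /line_sup -/(kap k) divfK// gt_eqF.
have b0 k : 0 <= b k.
  have [+ _] := @extension_le_line_sup _ _ _ _ p0 L1 L2 k 0 (2 ^ k) (lexx _).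
  exact: le_trans (normc_ge0 _).
have Q : 0 < (2 : R) `^ p by rewrite powR_gt0.
have [bz|bnz] := eqVneq (b (j + 1)) 0.
  have z : F1 (x +i* 2 ^ (j + 1)) = 0 /\ F2 (x +i* 2 ^ (j + 1)) = 0.
    have [+ +] := @extension_le_line_sup _ _ _ _ p0 L1 L2 (j + 1) x
      (2 ^ (j + 1)) (lexx _).
    rewrite -/b bz => n1 n2; split; apply/eqP; rewrite -normc_eq0 eq_le.
      by rewrite n1 normc_ge0.
    by rewrite n2 normc_ge0.
  rewrite (WE1 (j + 1)) (WE2 (j + 1)) z.1 z.2 !mulr0 invr0 !mulr0 subrr.
  rewrite Normc.normc0 !mulr_ge0 ?powR_ge0 ?invr_ge0 ?(ltW c0)//.
have B2 : 0 < b (j + 1) by rewrite lt_neqAle eq_sym bnz b0.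
have B21 : b (j + 1) <= b j by apply: line_sup_le => //; rewrite h1 -/h; lra.
have B1m : b j <= b (j - 1) by apply: line_sup_le => //; rewrite hm -/h; lra.
have bound k y s : 2 ^ k <= s ->
    normc (F1 (y +i* s)) <= b k /\ normc (F2 (y +i* s)) <= b k.
  exact: extension_le_line_sup.
have J y s : 0 < s -> jet2 F1 (y +i* s) /\ jet2 F2 (y +i* s).
  move=> s0; case: (inL2_integrable_sqr L1) => ? ?.
  by case: (inL2_integrable_sqr L2) => ? ?; split; exact: jet2_extension.
have kS k : kap (k + 1) = 2 `^ p * kap k by exact: wavelet_cstS.
clearbody b kap F1 F2 N W.
have Hyp' y : - L <= y <= L ->
    [/\ `|normc (F1 (y +i* h)) ^+ 2 - normc (F2 (y +i* h)) ^+ 2|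
          <= eps * b j ^+ 2,
        `|normc (F1 (y +i* (2 * h))) ^+ 2 - normc (F2 (y +i* (2 * h))) ^+ 2|
          <= eps * b (j + 1) ^+ 2,
        c * b j ^+ 2 <= normc (F1 (y +i* h)) ^+ 2 /\
        c * b j ^+ 2 <= normc (F2 (y +i* h)) ^+ 2 &
        c * b (j + 1) ^+ 2 <= normc (F1 (y +i* (2 * h))) ^+ 2 /\
        c * b (j + 1) ^+ 2 <= normc (F2 (y +i* (2 * h))) ^+ 2].
  have D k (u v e v' : R) : (`|(kap k * u) ^+ 2 - (kap k * v) ^+ 2| <=
      e * (kap k * v') ^+ 2) -> `|u ^+ 2 - v ^+ 2| <= e * v' ^+ 2.
    have k2 : 0 < kap k ^+ 2 by rewrite exprn_gt0.
    have -> : (kap k * u) ^+ 2 - (kap k * v) ^+ 2 =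
      kap k ^+ 2 * (u ^+ 2 - v ^+ 2) by ring.
    have -> : e * (kap k * v') ^+ 2 = kap k ^+ 2 * (e * v' ^+ 2) by ring.
    by rewrite normrM (gtr0_norm k2) ler_pM2l.
  have D' k (u v' : R) : c * (kap k * v') ^+ 2 <= (kap k * u) ^+ 2 ->
      c * v' ^+ 2 <= u ^+ 2.
    have k2 : 0 < kap k ^+ 2 by rewrite exprn_gt0.
    have -> : c * (kap k * v') ^+ 2 = kap k ^+ 2 * (c * v' ^+ 2) by ring.
    have -> : (kap k * u) ^+ 2 = kap k ^+ 2 * u ^+ 2 by ring.
    by rewrite ler_pM2l.
  move=> /Hyp; rewrite !NE !WE1 !WE2 h1 -/h !Normc.normcM !normc_real.
  rewrite !(gtr0_norm (kap0 _)) => -[A1 A2 [A3 A4] [A5 A6]].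
  by split; [exact: D A1|exact: D A2|split|split];
    [exact: D' A3|exact: D' A4|exact: D' A5|exact: D' A6].
have := @ratio_stability R F1 F2 h L eps c (b (j - 1)) (b j) (b (j + 1))
  h0 e01 c0 ec B2 B21 B1m J.
move=> /(_ _ _ _ Hyp' x hx) main.
have {}main : normc (F1 (x +i* (4 * h)) / F1 (x +i* (2 * h)) -
    F2 (x +i* (4 * h)) / F2 (x +i* (2 * h))) <=
    3 / c * (b (j - 1) / b (j + 1)) * eps `^ (4 / 15).
  by apply: main => y s hs; apply: bound; rewrite ?hm ?h1.
have k2 : kap (j + 2) = 2 `^ p * kap (j + 1).
  by rewrite -[j + 2]/(j + (1 + 1)) addrA kS.
have kq k (u v : R[i]) :
    ((2 `^ p * kap k)%:C * u) / ((kap k)%:C * v) = (2 `^ p)%:C * (u / v).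
  have kc : (kap k)%:C != 0 :> R[i] by rewrite fmorph_eq0 gt_eqF.
  by rewrite rmorphM invfM mulrACA (mulfK kc).
rewrite !WE1 !WE2 h1 h2 k2 !kq -mulrBr Normc.normcM normc_real (gtr0_norm Q).
apply: le_trans (ler_wpM2l (ltW Q) main) _.
pose q := (2 : R) `^ p.
have r1 : 1 <= b (j - 1) / b (j + 1).
  by rewrite ler_pdivlMr// mul1r; exact: le_trans B1m.
have rE : b (j - 1) / b (j + 1) = q ^+ 2 * (N (j - 1) / N (j + 1)).
  have kk : kap (j + 1) = q ^+ 2 * kap (j - 1).
    by rewrite expr2 -mulrA -kS subrK kS.
  rewrite !NE kk; field.
  by rewrite !gt_eqF.
have rr : b (j - 1) / b (j + 1) <=
    (q ^+ 2) `^ (4 / 3) * (N (j - 1) / N (j + 1)) `^ (4 / 3).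
  have NN : 0 <= N (j - 1) / N (j + 1).
    rewrite !NE divr_ge0 ?mulr_ge0 ?(ltW (kap0 _))//.
  rewrite -powRM ?sqr_ge0// -rE.
  by apply: le1r_powR => //; lra.
rewrite -/q.
have -> : 3 * q * (q ^+ 2) `^ (4 / 3) / c * (N (j - 1) / N (j + 1)) `^ (4 / 3) *
    eps `^ (4 / 15) = q * (3 / c * ((q ^+ 2) `^ (4 / 3) *
    (N (j - 1) / N (j + 1)) `^ (4 / 3)) * eps `^ (4 / 15)) by ring.
rewrite ler_wpM2l ?(ltW Q)// ler_wpM2r ?powR_ge0// ler_wpM2l//.
by rewrite divr_ge0// ltW.
Qed.

Unset Implicit Arguments.

Theorem theorem5p1 (R : realType) :
  exists (A : R -> R) (alpha alpha' : R -> R -> R),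
  (forall lambda : R, 0 < lambda < 1 ->
     tends_to0_exponentially (alpha lambda) /\
     tends_to0_exponentially (alpha' lambda)) /\
  forall p : R, 0 < p ->
  forall (eps c lambda M : R) (j : int) (f1 f2 f1hat f2hat : R -> R[i]),
  let W := wavelet_transform p in
  let N := wavelet_sup p f1 f2 in
  0 < eps < 1 -> 0 < c < 1 -> 0 < lambda < 1 -> 0 < M -> eps <= c ->
  is_fourier2 f1 f1hat -> is_fourier2 f2 f2hat ->
  ~ {ae @lebesgue_measure R, forall x, f1 x = 0} ->
  ~ {ae @lebesgue_measure R, forall x, f2 x = 0} ->
  {ae @lebesgue_measure R, forall w, w < 0 -> f1hat w = 0} ->
  {ae @lebesgue_measure R, forall w, w < 0 -> f2hat w = 0} ->
  (forall x : R, - (M * 2 ^ j) <= x <= M * 2 ^ j ->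
     [/\ `|normc (W j f1 x) ^+ 2 - normc (W j f2 x) ^+ 2| <= eps * N j ^+ 2,
         `|normc (W (j + 1) f1 x) ^+ 2 - normc (W (j + 1) f2 x) ^+ 2|
           <= eps * N (j + 1) ^+ 2,
         c * N j ^+ 2 <= normc (W j f1 x) ^+ 2 /\
         c * N j ^+ 2 <= normc (W j f2 x) ^+ 2 &
         c * N (j + 1) ^+ 2 <= normc (W (j + 1) f1 x) ^+ 2 /\
         c * N (j + 1) ^+ 2 <= normc (W (j + 1) f2 x) ^+ 2]) ->
  0 < 1 / 3 - alpha lambda M -> 0 < 4 / 5 - alpha' lambda M ->
  forall x : R, - (lambda ^+ 2 * M * 2 ^ j) <= x <= lambda ^+ 2 * M * 2 ^ j ->
    normc (W (j + 2) f1 x / W (j + 1) f1 x - W (j + 2) f2 x / W (j + 1) f2 x)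
    <= A p / c * (N (j - 1) / N (j + 1)) `^ (4 / 3)
       * eps `^ ((1 / 3 - alpha lambda M) * (4 / 5 - alpha' lambda M)).
Proof.
pose M0 (lambda : R) := 106 / (1 - lambda ^+ 2).
pose cut (lambda M : R) : R := if M0 lambda <= M then 0 else 1.
exists (fun p => 3 * 2 `^ p * ((2 `^ p) ^+ 2) `^ (4 / 3)), cut, cut.
split=> [lambda _|p p0 eps c lambda M j f1 f2 f1hat f2hat].
  by split; exact: exp_zero_eventually.
move=> W N e01 c01 l01 M_gt0 ec [L1 _ _] [L2 _ _] _ _ _ _ Hyp a1 a2 x hx.
have MM : M0 lambda <= M.
  by move: a1; rewrite /cut; case: ifP => // _; lra.
rewrite /cut MM !subr0 (_ : 1 / 3 * (4 / 5) = 4 / 15 :> R); last by field.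
have /andP[c0 _] := c01; have /andP[l0 l1] := l01.
apply: (@wavelet_ratio_stability R p eps c (M * 2 ^ j) j f1 f2) => //.
have h0 : 0 < (2 : R) ^ j by exact: exprz2_gt0.
have l2 : lambda ^+ 2 < 1 by rewrite exprn_ilt1 ?ltW.
have : 106 <= M * (1 - lambda ^+ 2).
  by rewrite -ler_pdivrMr//; lra.
move: hx h0; move: (2 ^ j) => h /andP[hx1 hx2] h0 HM.
have : 106 * h <= M * (1 - lambda ^+ 2) * h by rewrite ler_pM2r.
by move=> ?; apply/andP; split; lra.
Qed.
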